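(* Let $(X,G)$ be a $G$-system with finite topological entropy, let $\{F_n\}$ be a Følner sequence of $G$ satisfying $e_G\in F_1\subseteq F_2\subseteq\cdots$, and let $K\subseteq X$ be a nonempty Souslin set. Put $H=h_{\mathrm{top}}^B(K,\{F_n\})$ and $a=h_{\mathrm{top}}^*(X,G)$. If $H>a$, then for every $0\le h\le H-a$ there exists $K_h\subseteq K$ such that $$h\le h_{\mathrm{top}}^B(K_h,\{F_n\})\le h+a.$$
   Context: A $G$-system $(X,G)$ is a compact metric space $X$ with a countably infinite discrete amenable group $G$ (identity $e_G$) acting continuously on $X$ by homeomorphisms. A Følner sequence is a sequence $\{F_n\}$ of nonempty finite subsets of $G$ with $|F_n\triangle sF_n|/|F_n|\to0$ for every $s\in G$. A Souslin set is an analytic subset of $X$. For a finite cover $\mathcal U$ and finite $F\subseteq G$, $\mathcal U_F=\bigvee_{g\in F}g^{-1}\mathcal U$; $N(\mathcal U,K)$ is the minimal cardinality of a subfamily of $\mathcal U$ whose union contains $K$. The topological entropy is $h_{\mathrm{top}}(X,G)=\sup_{\mathcal U}\lim_n\frac1{|F_n|}\log N(\mathcal U_{F_n},X)$ over finite open covers $\mathcal U$ (independent of the Følner sequence). Tail entropy: for finite open covers $\mathcal U,\mathcal V$ of $X$, $N(\mathcal U|\mathcal V)=\sup_{V\in\mathcal V}N(\mathcal U,V)$, $h_{\mathrm{top}}(G,\mathcal U|\mathcal V)=\lim_n\frac1{|F_n|}\log N(\mathcal U_{F_n}|\mathcal V_{F_n})$ (independent of the Følner sequence), and $h^*_{\mathrm{top}}(X,G)=\inf_{\mathcal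 V}\sup_{\mathcal U}h_{\mathrm{top}}(G,\mathcal U|\mathcal V)$. Bowen topological entropy of $K\subseteq X$: for $\mathbb U=\{U_g\}_{g\in F_n}$ with $U_g\in\mathcal U$, put $m(\mathbb U)=|F_n|$ and $X(\mathbb U)=\bigcap_{g\in F_n}g^{-1}U_g$; let $\mathcal W_{F_n}(\mathcal U)$ be the set of all such $\mathbb U$. For $s\ge0$, $N\in\mathbb N$, let $\mathcal M(K,\mathcal U,N,s,\{F_n\})=\inf\sum_{\mathbb U\in\Lambda}e^{-s\,m(\mathbb U)}$, the infimum over all $\Lambda\subseteq\bigcup_{j\ge N}\mathcal W_{F_j}(\mathcal U)$ with $K\subseteq\bigcup_{\mathbb U\in\Lambda}X(\mathbb U)$; $\mathcal M(K,\mathcal U,s,\{F_n\})=\lim_{N\to\infty}\mathcal M(K,\mathcal U,N,s,\{F_n\})$. Then $h_{\mathrm{top}}^B(K,\mathcal U,\{F_n\})=\inf\{s:\mathcal M(K,\mathcal U,s,\{F_n\})=0\}$ and $h_{\mathrm{top}}^B(K,\{F_n\})=\sup_{\mathcal U}h_{\mathrm{top}}^B(K,\mathcal U,\{F_n\})$ over finite open covers $\mathcal U$. *)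

(* Defs.v *)
From HB Require Import structures.
From mathcomp Require Import all_boot all_order all_algebra finmap.
From mathcomp Require Import all_classical all_reals all_analysis.

Set Implicit Arguments.
Unset Strict Implicit.
Unset Printing Implicit Defensive.

Import Order.TTheory GRing.Theory Num.Theory.
Import numFieldNormedType.Exports.

Local Open Scope classical_set_scope.
Local Open Scope ring_scope.
Local Open Scope ereal_scope.

(* The group is discrete: [groupType] carries no topology, so continuity of the
   action is continuity of each translation [act g]. *)
Definition continuous_action (G : groupType) (X : topologicalType)
    (act : G -> X -> X) : Prop :=
  [/\ forall x, act 1%g x = x,
      forall g h x, act (g * h)%g x = act g (act h x)
    & forall g, continuous (act g)].

Definition ltrans (G : groupType) (s : G) (A : {fset G}) : {fset G} :=
  [fset (s * g)%g | g in A]%fset.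

Definition symdiff (G : groupType) (A B : {fset G}) : {fset G} :=
  ((A `\` B) `|` (B `\` A))%fset.

Definition folner (R : realType) (G : groupType) (F : nat -> {fset G}) : Prop :=
  (forall n, F n != fset0) /\
  (forall s : G,
    (#|` symdiff (F n) (ltrans s (F n))|%:R / #|` F n|%:R : R)%R
      @[n --> \oo] --> (0 : R)%R).

Definition amenable (R : realType) (G : groupType) : Prop :=
  exists F : nat -> {fset G}, folner R F.

(* Analytic sets: the empty set and the continuous images of the Baire space. *)
Definition souslin (X : topologicalType) (K : set X) : Prop :=
  K = set0 \/
  exists f : prod_topology (fun _ : nat => nat) -> X,
    continuous f /\ range f = K.

Definition finite_open_cover (X : topologicalType) : set (set (set X)) :=
  [set U | [/\ finite_set U, forall A, U A -> open A
             & \bigcup_(A in U) A = [set: X]]].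

Section entropy.
Variables (R : realType) (G : groupType) (X : topologicalType).
Variables (act : G -> X -> X) (F : nat -> {fset G}).
Implicit Types (U V : set (set X)) (K : set X) (E : {fset G}).

(* The members of the join over g in E of g^-1 U are the intersections of the
   g^-1 (c g), one member c g of U being chosen for each g in E. *)
Definition join_cover U E : set (set X) :=
  [set \bigcap_(g in [set` E]) (act g @^-1` c g) |
    c in [set c : G -> set X | forall g, g \in E -> U (c g)]].

(* Infimum over natural numbers, hence a minimum; +oo if no finite subfamily
   of U covers K. *)
Definition cover_num U K : \bar R :=
  ereal_inf [set (#|` S|%:R)%:E |
    S in [set S : {fset set X} |
           [set` S] `<=` U /\ K `<=` \bigcup_(A in [set` S]) A]].

Definition cond_cover_num U V : \bar R :=
  ereal_sup [set cover_num U B | B in V].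

Definition top_entropy_cover U : \bar R :=
  limn (fun n => (#|` F n|%:R^-1)%:E *
                 lne (cover_num (join_cover U (F n)) [set: X])).

Definition top_entropy : \bar R :=
  ereal_sup [set top_entropy_cover U | U in @finite_open_cover X].

Definition cond_entropy U V : \bar R :=
  limn (fun n => (#|` F n|%:R^-1)%:E *
                 lne (cond_cover_num (join_cover U (F n))
                                     (join_cover V (F n)))).

Definition tail_entropy : \bar R :=
  ereal_inf
    [set ereal_sup [set cond_entropy U V | U in @finite_open_cover X] |
      V in @finite_open_cover X].

(* A family (U_g)_{g in E} of members of U is a finite map with domain E. *)
Definition words U E : set {fmap G -> set X} :=
  [set u | domf u = E /\ forall g : domf u, U (u g)].

Definition word_len (u : {fmap G -> set X}) : nat := #|` domf u|.

Definition word_set (u : {fmap G -> set X}) : set X :=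
  \bigcap_(g in [set: domf u]) (act (val g) @^-1` u g).

Definition bowen_pre K U (N : nat) (s : R) : \bar R :=
  ereal_inf
    [set \esum_(u in L) (expR (- (s * (word_len u)%:R)))%:E |
      L in [set L : set {fmap G -> set X} |
             L `<=` \bigcup_(j >= N) words U (F j) /\
             K `<=` \bigcup_(u in L) word_set u]].

Definition bowen_measure K U (s : R) : \bar R :=
  limn (fun N => bowen_pre K U N s).

Definition bowen_entropy_cover K U : \bar R :=
  ereal_inf [set s%:E | s in [set s : R | (0 <= s)%R /\
                                          bowen_measure K U s = 0]].

Definition bowen_entropy K : \bar R :=
  ereal_sup [set bowen_entropy_cover K U | U in @finite_open_cover X].

End entropy.

(* Main.v *)
From HB Require Import structures.
Require Import Defs.
From mathcomp Require Import all_boot all_order all_algebra finmap.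
From mathcomp Require Import all_classical all_reals all_analysis.
From mathcomp Require Import ring lra.

Set Implicit Arguments.
Unset Strict Implicit.
Unset Printing Implicit Defensive.

Import Order.TTheory GRing.Theory Num.Theory.
Import numFieldNormedType.Exports.

Local Open Scope classical_set_scope.
Local Open Scope ring_scope.

(** The tail entropy over a fine cover [U] bounds what is lost when any other cover
    is replaced by [U], and Bowen entropy is countably stable; so it suffices to
    find, for [s] just below [h], a subset [L] of [K] whose content of exponent [s]
    is positive for some cover, while its content for [U] vanishes at every larger
    exponent. After reducing the Souslin set to a compact one of positive content,
    [L] is carved out with mass distributions, i.e. functionals [l] with
    [l (X(u)) <= r u] for all deep words [u], where [r u] is a multiple of
    [expR (- s |u|)]. If [l] is nearly extreme, almost all of its mass lies on the
    tight words, those with [l (X(u)) >= r u / 2]: otherwise mass could be moved in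
    two opposite directions. At each length there are few disjoint tight words, so
    the intersection of tight parts taken at increasing depths is covered cheaply
    and still carries mass. Finitely additive functionals suffice, since compact
    sets have finite subcovers; and losing an arbitrarily small part of the exponent
    replaces the increasing sets lemma and Vitali coverings. *)

(** * Finitely additive mass distributions *)

(** Two covers share the work. Masses are bounded on the words of a fine cover [V], while coverings
    use words of a coarser [U], whose members swallow the stars of [V]; the selected disjoint words
    can then be enlarged so as to cover everything they meet. The mismatch is harmless: [V] only has
    to give a lower bound, and Bowen entropy is a supremum over covers, while the upper bound for
    [U] passes to all covers through the tail entropy. That transfer serves twice: for [L] and, by
    contraposition, for [K], whose entropy of at least [h + a] prevents it from being null for [U]
    at an exponent just below [h]. The comparison of words rests on the nesting of the [F n], by
    which words of equal length have equal domain. Since [cond_entropy] is a [limn], a bound on it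
    says something about large [n] only once the sequence is known to converge; this is the role of
    the Ornstein-Weiss lemma. *)

Section GeneralizedLimit.
Variable R : realType.

Lemma ultra_fmap (T S : Type) (f : T -> S) (U : set_system T) :
  UltraFilter U -> UltraFilter (f @ U).
Proof.
move=> UU; have FU : ProperFilter U by apply: ultra_proper.
apply: Build_UltraFilter => G FG fUG; apply/seteqP; split=> // A GA.
have [//|UnA] := in_ultra_setVsetC (f @^-1` A) UU.
have : G (A `&` ~` A) by apply: filterI => //; exact: fUG.
by rewrite setICr => /filter_not_empty.
Qed.

(** Limit along an ultrafilter refining [\oo]: a bounded sequence stays in a compact segment, hence
    converges along it. For unbounded sequences [lim] may be a default value, whence the bounds
    [M]. *)
Lemma generalized_limit : exists L : (nat -> R) -> R,
  [/\ forall a b (M : R), (forall n, `|a n| <= M) -> (forall n, `|b n| <= M) ->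
        L (fun n => a n + b n) = L a + L b,
      forall a b (M : R), (forall n, `|a n| <= M) -> (forall n, `|b n| <= M) ->
        (\forall n \near \oo, a n <= b n) -> L a <= L b
    & forall c, L (fun=> c) = c].
Proof.
have [U [UU ooU]] := ultraFilterLemma (@eventually_filter).
have FU : ProperFilter U := @ultra_proper _ U UU.
have cvU (a : nat -> R) M : (forall n, `|a n| <= M) -> cvg (a @ U).
  move=> aM; have := @segment_compact R (- M) M.
  rewrite compact_ultra => /(_ (a @ U) (ultra_fmap a UU)) H.
  have [|l [_ al]] := H; last by apply/cvg_ex; exists l.
  suff: U (a @^-1` [set` `[- M, M]]) by [].
  suff -> : a @^-1` [set` `[- M, M]] = setT by exact: filterT.
  by rewrite -subTset => n _ /=; rewrite in_itv /= -ler_norml.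
exists (fun a => lim (a @ U)); split=> [a b M aM bM|a b M aM bM ab|c].
- apply: cvg_lim; first exact: norm_hausdorff.
  exact: cvgD (cvU _ _ aM) (cvU _ _ bM).
- exact: ler_lim (cvU _ _ aM) (cvU _ _ bM) (ooU _ ab).
- exact: norm_lim_cst.
Qed.

End GeneralizedLimit.

Section Approachability.
Variables (R : realType) (X : Type) (I : finType) (S : I -> set X) (r : I -> R).
Variable K : set X.
Hypothesis r_ge0 : forall i, 0 <= r i.
Hypothesis weights : forall g : I -> R, (forall i, 0 <= g i) ->
  exists2 x, K x & \sum_i g i * \1_(S i) x <= \sum_i g i * r i.

Lemma sqr_max0D (a b : R) :
  Num.max 0 (a + b) ^+ 2 <= Num.max 0 a ^+ 2 + 2 * (Num.max 0 a * b) + b ^+ 2.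
Proof.
case: (lerP 0 (a + b)) => ab; case: (lerP 0 a) => a0.
- by rewrite le_eqVlt; apply/orP; left; apply/eqP; ring.
- by rewrite expr0n /= mul0r mulr0 !add0r; nra.
- by rewrite expr0n /=; have := sqr_ge0 (a + b); rewrite sqrrD; lra.
- by rewrite expr0n /= mul0r mulr0 !add0r sqr_ge0.
Qed.

(* Blackwell's approachability: each new point is chosen against the current
   excesses used as weights, so that the sum of their squares grows linearly. *)
Lemma approachability n : exists xs : seq X,
  [/\ size xs = n, forall A, K `<=` A -> \sum_(x <- xs) \1_A x = n%:R :> R &
    \sum_i Num.max 0 (\sum_(x <- xs) \1_(S i) x - n%:R * r i) ^+ 2
      <= n%:R * \sum_i (1 + r i) ^+ 2].
Proof.
elim: n => [|n [xs [sz Kxs IH]]].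
  exists [::]; split=> // [A _|]; first by rewrite big_nil.
  rewrite mul0r big1 // => i _.
  by rewrite big_nil mul0r subr0 maxxx expr0n.
pose g i := Num.max 0 (\sum_(x <- xs) \1_(S i) x - n%:R * r i).
have g0 i : 0 <= g i by rewrite le_max lexx.
have [x Kx gx] := weights g0.
exists (x :: xs); split=> [|A KA|] /=; first by rewrite sz.
  by rewrite big_cons Kxs // indicE mem_set; [rewrite [in RHS]mulrS|exact: KA].
apply: (@le_trans _ _ (\sum_i (g i ^+ 2 +
    2 * (g i * (\1_(S i) x - r i)) + (1 + r i) ^+ 2))).
  apply: ler_sum => i _; rewrite big_cons.
  have -> : \1_(S i) x + \sum_(j <- xs) \1_(S i) j - n.+1%:R * r i =
     (\sum_(x <- xs) \1_(S i) x - n%:R * r i) + (\1_(S i) x - r i).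
    by rewrite -natr1; ring.
  apply: (le_trans (sqr_max0D _ _)); rewrite lerD2l.
  have ri := r_ge0 i.
  by rewrite indicE; case: (_ \in _); rewrite /=; nra.
rewrite 2!big_split /= -mulr_sumr -[n.+1%:R]natr1 [leRHS]mulrDl mul1r lerD2r.
apply: (le_trans _ IH); rewrite -/g gerDl pmulr_rle0 //.
under eq_bigr do rewrite mulrBr.
by rewrite sumrB subr_le0.
Qed.

(** A minimax statement: for each system of weights some point is good on average, and the
    conclusion is one probability measure good for all [i] at once, up to [eta]. The excesses after
    [n] points are of order [sqrt n], so that dividing by a large [n] makes them small. *)
Lemma empirical_measure (eta : R) : 0 < eta -> exists xs : seq X,
  [/\ (0 < size xs)%N, forall A, K `<=` A ->
      \sum_(x <- xs) \1_A x = (size xs)%:R :> R &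
    forall i, \sum_(x <- xs) \1_(S i) x <= (size xs)%:R * (r i + eta)].
Proof.
move=> eta0; pose C := \sum_i (1 + r i) ^+ 2.
have C0 : 0 <= C by apply: sumr_ge0 => i _; exact: sqr_ge0.
pose n := (Num.truncn (C / eta ^+ 2)).+1.
have nC : C < n%:R * eta ^+ 2.
  by rewrite -ltr_pdivrMr ?exprn_gt0 // truncnS_gt.
have [xs [sz Kxs xsC]] := approachability n.
exists xs; split; rewrite ?sz // => i.
set c := \sum_(x <- xs) _.
rewrite leNgt; apply/negP => lt_c.
have : Num.max 0 (c - n%:R * r i) ^+ 2 <= n%:R * C.
  apply: (le_trans _ xsC); rewrite (bigD1 i) //= lerDl.
  by apply: sumr_ge0 => j _; exact: sqr_ge0.
have n0 : 0 < n%:R :> R by [].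
rewrite leNgt => /negP; apply.
apply: (@lt_le_trans _ _ (n%:R * (n%:R * eta ^+ 2))).
  by rewrite ltr_pM2l.
have -> : n%:R * (n%:R * eta ^+ 2) = (n%:R * eta) ^+ 2 by ring.
have ne0 : 0 <= n%:R * eta by rewrite mulr_ge0 // ltW.
rewrite ler_pXn2r // ?nnegrE // ?le_max ?lexx //.
by rewrite lerBrDl -mulrDr (ltW lt_c) orbT.
Qed.

End Approachability.

Section FinitelyAdditive.
Variables (R : realType) (X : Type).
Implicit Types (l : set X -> R) (A B : set X).

(** Defined on all subsets: with finite additivity alone no algebra of measurable sets has to be
    carried along. *)
Definition finadd l : Prop :=
  (forall A, 0 <= l A) /\
  (forall A B, A `&` B = set0 -> l (A `|` B) = l A + l B).

Section Theory.
Variable l : set X -> R.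
Hypothesis fl : finadd l.

Lemma finadd_set0 : l set0 = 0.
Proof.
have := fl.2 set0 set0; rewrite setI0 setU0 => /(_ erefl)/eqP.
by rewrite -subr_eq0 opprD addrA subrr add0r oppr_eq0 => /eqP.
Qed.

Lemma finadd_setID A B : l A = l (A `&` B) + l (A `\` B).
Proof.
rewrite -fl.2; first by rewrite setUIDK.
by rewrite setDE setIACA setICr setI0.
Qed.

Lemma le_finadd A B : A `<=` B -> l A <= l B.
Proof.
by move=> AB; rewrite (finadd_setID B A) (setIidr AB) lerDl fl.1.
Qed.

Lemma finadd_setU_le A B : l (A `|` B) <= l A + l B.
Proof.
rewrite (finadd_setID _ A) setIUl setIid setUidl; last exact: subIsetr.
by rewrite lerD2l; apply: le_finadd => x [[]].
Qed.

Lemma finadd_bigcup_le (T : choiceType) (S : T -> set X) (s : {fset T}) :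
  l (\bigcup_(u in [set` s]) S u) <= \sum_(u <- s) l (S u).
Proof.
rewrite bigcup_fset.
elim/big_ind2 : _ => [||//]; first by rewrite finadd_set0.
move=> A x B y Ax By; apply: (le_trans (finadd_setU_le _ _)).
exact: lerD.
Qed.

Lemma finadd_bigsetU (I : finType) (P : I -> set X) (J : pred I) :
  (forall i j x, P i x -> P j x -> i = j) ->
  l (\big[setU/set0]_(i | J i) P i) = \sum_(i | J i) l (P i).
Proof.
move=> Pdisj.
have : uniq (index_enum I) by exact: index_enum_uniq.
elim: (index_enum I) => [|i s IH]; first by rewrite !big_nil finadd_set0.
rewrite /= => /andP[i_s us]; rewrite !big_cons; case: (J i); last exact: IH.
rewrite fl.2 ?IH //; apply/seteqP; split=> // x [Pi].
rewrite -bigcup_seq_cond => -[j /= /andP[js _] Pj].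
by move: i_s; rewrite (Pdisj _ _ _ Pi Pj) js.
Qed.

End Theory.

Lemma finadd_setI l B : finadd l -> finadd (fun A => l (A `&` B)).
Proof.
move=> fl; split=> [A|A A' AA']; first exact: fl.1.
by rewrite setIUl fl.2 // setIACA AA' set0I.
Qed.

(** Compactness of the set of mass distributions of bounded total mass, by taking the generalized
    limit set by set. *)
Lemma finadd_lim (a : nat -> set X -> R) (M : R) :
  (forall n, finadd (a n)) -> (forall n, a n setT <= M) ->
  exists l, [/\ finadd l,
    forall A c, (\forall n \near \oo, a n A <= c) -> l A <= c &
    forall A c, (\forall n \near \oo, c <= a n A) -> c <= l A].
Proof.
move=> fa aM; have [L [LD Lle Lc]] := generalized_limit R.
have bnd A n : `|a n A| <= M.
  rewrite ger0_norm; last exact: (fa n).1.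
  by apply: (le_trans _ (aM n)); apply: le_finadd.
have cb (c : R) A n : `|a n A| <= Num.max M `|c|.
  by rewrite (le_trans (bnd A n)) // le_max lexx.
have cc (c : R) (n : nat) : `|c| <= Num.max M `|c|.
  by rewrite le_max lexx orbT.
exists (fun A => L (fun n => a n A)); split=> [|A c ac|A c ac]; first split.
- move=> A; rewrite -(Lc 0); apply: Lle (cc 0) (cb 0 A) _.
  by near=> n; exact: (fa n).1.
- move=> A B AB; rewrite -(LD _ _ M) //; congr L.
  by apply/funext => n; exact: (fa n).2.
- by rewrite -(Lc c); apply: Lle (cb c A) (cc c) ac.
- by rewrite -(Lc c); apply: Lle (cc c) (cb c A) ac.
Unshelve. all: by end_near. Qed.

Lemma finadd_empirical (xs : seq X) (c : R) : 0 <= c ->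
  finadd (fun A => (\sum_(x <- xs) \1_A x) / c).
Proof.
move=> c0; split=> [A|A B AB].
  by rewrite divr_ge0 // sumr_ge0 // => x _; rewrite indicE.
rewrite -mulrDl -big_split /=; congr (_ / _).
apply: eq_bigr => x _; rewrite !indicE in_setU.
case: (boolP (x \in A)) => [xA|_]; case: (boolP (x \in B)) => [xB|_] //=.
- have : (A `&` B) x by split; exact: set_mem.
  by rewrite AB.
- by rewrite addr0.
- by rewrite add0r.
- by rewrite addr0.
Qed.

(** Minimax settles the finitely many constraints in [D n] with slack [n.+1^-1]; the slack vanishes
    in the generalized limit, which satisfies every constraint that is eventually present. *)
Lemma frostman (T : choiceType) (S : T -> set X) (r : T -> R) (K : set X)
    (D : nat -> {fset T}) :
  (forall u, 0 <= r u) ->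
  (forall n (g : T -> R), (forall u, 0 <= g u) ->
    exists2 x, K x &
      \sum_(u <- D n) g u * \1_(S u) x <= \sum_(u <- D n) g u * r u) ->
  exists l, [/\ finadd l, l setT = 1, l (~` K) = 0 &
    forall u, (\forall n \near \oo, u \in D n) -> l (S u) <= r u].
Proof.
move=> r0 W.
have E n : exists xs : seq X, [/\ (0 < size xs)%N, forall A, K `<=` A ->
      \sum_(x <- xs) \1_A x = (size xs)%:R :> R &
    forall u, u \in D n -> \sum_(x <- xs) \1_(S u) x
      <= (size xs)%:R * (r u + n.+1%:R^-1)].
  have [|g g0|//|xs [sz Kxs xsr]] := @empirical_measure R X (D n)
      (fun u => S (val u)) (fun u => r (val u)) K _ _ n.+1%:R^-1.
  - by move=> i; exact: r0.
  - pose g' u := if insub u is Some v then g v else 0.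
    have g'0 u : 0 <= g' u by rewrite /g'; case: insubP.
    have [x Kx H] := W n g' g'0; exists x => //.
    have E (h : D n -> R) : \sum_v g' (val v) * h v = \sum_v g v * h v.
      by apply: eq_bigr => v _; rewrite /g' valK.
    by move: H; rewrite !big_seq_fsetE /= !E.
  - by exists xs; split=> // u uD; exact: xsr [` uD]%fset.
pose xs n := sval (cid (E n)).
have xsP n := svalP (cid (E n)).
pose a n (A : set X) := (\sum_(x <- xs n) \1_A x) / (size (xs n))%:R : R.
have sz0 n : 0 < (size (xs n))%:R :> R by rewrite ltr0n; case: (xsP n).
have fa n : finadd (a n) by apply: finadd_empirical; exact: ltW.
have aK n A : K `<=` A -> a n A = 1.
  move=> KA; have [_ H _] := xsP n.
  by rewrite /a H // divff // gt_eqF ?sz0.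
have aT n : a n setT <= 1 by rewrite aK.
have [l [fl lle lge]] := finadd_lim fa aT.
have l1 A : K `<=` A -> l A = 1.
  move=> KA; apply/eqP; rewrite eq_le lle ?lge //; near=> n; by rewrite aK.
exists l; split=> //; first exact: l1.
  by have := l1 _ (@subsetT _ K); rewrite (finadd_setID fl _ K) setTI l1 // setTD;
    rewrite -[in RHS](addr0 1) => /addrI.
move=> u uD; apply/ler_addgt0Pr => e e0; apply: lle.
near=> n; rewrite /a ler_pdivrMr // mulrC.
apply: (@le_trans _ _ ((size (xs n))%:R * (r u + n.+1%:R^-1))).
  by case: (xsP n) => _ _; apply; near: n.
rewrite ler_pM2l // lerD2l ltW //; near: n.
exact: near_infty_natSinv_lt (PosNum e0).
Unshelve. all: by end_near. Qed.

End FinitelyAdditive.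

(** More unknowns (the elements of [J]) than equations (those of [L]): take a nonzero solution and
    divide by its coordinate of largest absolute value. *)
Lemma exists_normalized_kernel (R : realType) (I L : finType) (J : {set I})
    (C : I -> L -> R) : (#|L| < #|J|)%N ->
  exists f : I -> R, [/\ forall i, i \notin J -> f i = 0,
    exists2 i, i \in J & `|f i| = 1, forall i, `|f i| <= 1 &
    forall k, \sum_i f i * C i k = 0].
Proof.
move=> LJ; have [x0 x0J] : exists x, x \in J.
  by apply/card_gt0P; exact: leq_ltn_trans LJ.
pose A := \matrix_(i < #|J|, k < #|L|) C (enum_val i) (enum_val k).
have kA : kermx A != 0.
  by rewrite -mxrank_eq0 mxrank_ker subn_eq0 -ltnNge (leq_ltn_trans (rank_leq_col A)).
pose v := nz_row (kermx A).
have v0 : v != 0 by rewrite nz_row_eq0.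
have vA : v *m A = 0.
  by apply/sub_kermxP; exact: nz_row_sub.
have [j vj] : exists j, v 0 j != 0.
  by move/matrix0Pn : v0 => [i [j]]; rewrite ord1 => ?; exists j.
pose m := [arg max_(i > j) `|v 0 i|]%O.
have mP i : `|v 0 i| <= `|v 0 m|.
  by rewrite /m; case: Order.TotalTheory.arg_maxP => // k _ /(_ i); exact.
have m0 : 0 < `|v 0 m| by apply: lt_le_trans (mP j); rewrite normr_gt0.
exists (fun x => if x \in J then v 0 (enum_rank_in x0J x) / v 0 m else 0).
split.
- by move=> i /negbTE ->.
- exists (enum_val m); first exact: enum_valP.
  by rewrite enum_valP enum_valK_in divff ?normr1 // -normr_gt0.
- move=> i; case: ifP => _; last by rewrite normr0.
  by rewrite normrM normfV ler_pdivrMr // mul1r.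
move=> k; transitivity (\sum_(i in J) v 0 (enum_rank_in x0J i) / v 0 m * C i k).
  by rewrite [RHS]big_mkcond; apply: eq_bigr => i _; case: ifP; rewrite ?mul0r.
rewrite big_enum_val /=; under eq_bigr do rewrite enum_valK_in mulrAC.
rewrite -mulr_suml; apply/eqP; rewrite mulf_eq0; apply/orP; left; apply/eqP.
have := congr1 (fun B : 'M[R]_(1, #|L|) => B 0 (enum_rank k)) vA.
rewrite [X in _ = X]mxE mxE => vAk; apply: etrans vAk.
by apply: eq_bigr => i _; rewrite mxE enum_rankK.
Qed.

Section Tight.
Variables (R : realType) (X : Type) (T : choiceType) (S : T -> set X).
Variables (r : T -> R) (D : set T) (K : set X).

Definition feasible (l : set X -> R) : Prop :=
  [/\ finadd l, l (~` K) = 0 & forall u, D u -> l (S u) <= r u].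

(** The factor 1/2 is the room for a perturbation: where [l (S u) < r u / 2], even doubling the mass
    respects the bound. *)
Definition tight (Q : set T) (l : set X -> R) : set X :=
  \bigcup_(u in [set u | Q u /\ r u / 2 <= l (S u)]) S u.

(* A functional that nearly maximizes the sum of squares over a fine partition
   is nearly extreme among the feasible ones; the mass outside the tight sets
   could otherwise be moved in two opposite directions. *)
Lemma tight_concentration (l0 : set X -> R) (I : finType) (P : I -> set X)
    (b eps : R) (Sh : {fset T}) (Q : nat -> set T) :
  feasible l0 ->
  (forall i j x, P i x -> P j x -> i = j) ->
  \big[setU/set0]_i P i = setT ->
  (forall l, feasible l -> forall i, l (P i) <= b) ->
  0 <= b -> 0 < eps -> b * (#|` Sh|.+1)%:R < eps / 2 ->
  (forall p q, (p <= q)%N -> Q p `<=` Q q) ->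
  D `<=` [set` Sh] `|` \bigcup_p Q p ->
  exists l p, [/\ feasible l, l setT = l0 setT &
    l (~` tight (Q p) l) <= eps].
Proof.
move=> l0F Pdisj Pcov Pb b0 eps0 bSh Qmono DQ.
pose Phi l : R := \sum_i l (P i) ^+ 2.
pose E := [set Phi l | l in [set l | feasible l /\ l setT = l0 setT]].
have [fl0 l0K l0D] := l0F.
have supE : has_sup E.
  split; first by exists (Phi l0); exists l0.
  exists (\sum_(i : I) l0 setT ^+ 2) => _ [l [[fl _ _] lT] <-].
  apply: ler_sum => i _; rewrite ler_pXn2r ?nnegrE ?fl.1 // ?fl0.1 //.
  by rewrite -lT; apply: le_finadd.
(* Chosen so that the cells of mass below [delta] carry at most [eps / 2] together. *)
pose delta := eps / (2 * #|I|.+1%:R).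
have delta0 : 0 < delta by rewrite divr_gt0 // mulr_gt0.
have [_ [l [lF lT] <-] Phil] := sup_adherent (exprn_gt0 2 delta0) supE.
have [fl lK lD] := lF.
exists l; apply: contrapT => /forallNP H.
have {}H p : eps < l (~` tight (Q p) l).
  by rewrite ltNge; apply/negP => le_eps; apply: (H p).
pose B p := ~` tight (Q p) l.
have faB p : finadd (fun A => l (A `&` B p)) by exact: finadd_setI.
have aBT p : l (setT `&` B p) <= l setT by apply: le_finadd.
(* [mB] is the part of [l] that stays outside the tight sets however large [p] is; it has mass at
   least [eps] and is the material to be moved. *)
have [mB [fm mle mge]] := finadd_lim faB aBT.
have mBl A : mB A <= l A.
  by apply: mle; near=> p; apply: le_finadd.
have mBT : eps <= mB setT.
  by apply: mge; near=> p; rewrite setTI; exact/ltW/H.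
have sumP (A : set X) (m : set X -> R) : finadd m ->
    \sum_i m (A `&` P i) = m A.
  move=> fm'; rewrite -(@finadd_bigsetU _ _ m fm' I (fun i => A `&` P i) xpredT).
    by rewrite -big_distrr /= Pcov setIT.
  by move=> i j x [_ Pi] [_ Pj]; exact: Pdisj Pi Pj.
(* The cells with a substantial part of [mB]. Each holds at most [b], so there are more than
   [#|Sh| + 1] of them: more than the constraints to be kept, namely the mass of each word of [Sh]
   and the total mass ([None]). *)
pose J := [set i | delta <= mB (P i)]%SET.
have cardJ : (#|{: option Sh}| < #|J|)%N.
  rewrite card_option -cardfE ltnNge; apply/negP => leJ.
  suff : mB setT <= eps / 2 + eps / 2 - (eps / 2 - b * #|` Sh|.+1%:R).
    by rewrite -splitr; lra.
  rewrite -(sumP setT _ fm) (bigID (mem J)) /=.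
  have -> : eps / 2 + eps / 2 - (eps / 2 - b * #|` Sh|.+1%:R) =
    b * #|` Sh|.+1%:R + eps / 2 by ring.
  apply: lerD.
    apply: (@le_trans _ _ (\sum_(i in J) b)).
      apply: ler_sum => i _; rewrite setTI; apply: (le_trans (mBl _)).
      exact: Pb.
    rewrite sumr_const -[leLHS]mulr_natr ler_wpM2l // ler_nat.
    by rewrite (leq_trans leJ).
  apply: (@le_trans _ _ (\sum_(i | i \notin J) delta)).
    apply: ler_sum => i; rewrite inE -ltNge setTI => /ltW.
    exact.
  apply: (@le_trans _ _ (\sum_(i : I) delta)).
    rewrite [leRHS](bigID (mem J)) /= lerDr sumr_ge0 // => i _; exact: ltW.
  rewrite sumr_const -[leLHS]mulr_natr /delta -mulrA invfM -mulrA mulrA.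
  rewrite ler_piMr ?divr_ge0 ?(ltW eps0) // mulrC ler_pdivrMr // mul1r ler_nat.
  by rewrite leqW // max_card.
(* [f] is a density with respect to [mB], constant on cells. Both [l + sg] and [l - sg] will be
   feasible: words of [Sh] keep their mass, tight words are not charged by [mB], and the others have
   room. *)
have [f [fJ [i0 i0J fi0] f1 fC]] := @exists_normalized_kernel R I _ J
  (fun i (k : option Sh) =>
     if k is Some u then mB (S (val u) `&` P i) else mB (P i)) cardJ.
pose sg A := \sum_i f i * mB (A `&` P i).
have sgmB A : `|sg A| <= mB A.
  apply: (le_trans (ler_norm_sum _ _ _)); rewrite -(sumP A mB fm).
  apply: ler_sum => i _; rewrite normrM (ger0_norm (fm.1 _)).
  by rewrite ler_piMl ?fm.1.
have sgT : sg setT = 0.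
  by rewrite -(fC None); apply: eq_bigr => i _; rewrite setTI.
have lpF (e : R) : `|e| <= 1 ->
    feasible (fun A => l A + e * sg A) /\ l setT + e * sg setT = l0 setT.
  move=> e1; rewrite sgT mulr0 addr0; split=> //.
  have esg A : `|e * sg A| <= mB A.
    by rewrite normrM (le_trans _ (sgmB A)) // ler_piMl.
  split.
  - split=> [A|A A' AA'].
      by have := esg A; rewrite ler_norml => /andP[+ _]; have := mBl A; lra.
    rewrite fl.2 //.
    have -> : sg (A `|` A') = sg A + sg A'.
      rewrite /sg -big_split /=; apply: eq_bigr => i _.
      by rewrite setIUl fm.2 ?mulrDr // setIACA AA' set0I.
    by ring.
  - have := esg (~` K); have := mBl (~` K); rewrite lK => mK.
    have -> : mB (~` K) = 0 by apply/eqP; rewrite eq_le mK fm.1.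
    by rewrite normr_le0 => /eqP ->; rewrite addr0.
  move=> u Du.
  have [uSh|[p _ uQ]] := DQ _ Du.
    have -> : sg (S u) = 0 by rewrite -(fC (Some [` uSh]%fset)).
    by rewrite mulr0 addr0; exact: lD.
  have [tu|ntu] := lerP (r u / 2) (l (S u)).
    suff mu0 : mB (S u) = 0.
      have := esg (S u); rewrite mu0 normr_le0 => /eqP ->.
      by rewrite addr0; exact: lD.
    apply/eqP; rewrite eq_le fm.1 andbT; apply: mle; exists p => // q /= pq.
    rewrite (_ : _ `&` _ = set0) ?(finadd_set0 fl) //.
    apply/seteqP; split=> // x [Sx]; apply; exists u => //.
    by split => //; exact: Qmono uQ.
  have := esg (S u); rewrite ler_norml => /andP[_]; have := mBl (S u).
  by lra.
have PhiE (e : R) : Phi (fun A => l A + e * sg A) =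
    Phi l + e * (2 * \sum_i l (P i) * sg (P i)) + e ^+ 2 * \sum_i sg (P i) ^+ 2.
  rewrite !mulr_sumr /Phi -!big_split /=; apply: eq_bigr => i _; ring.
have Phile (e : R) : `|e| <= 1 -> Phi (fun A => l A + e * sg A) <= sup E.
  move=> e1; have [F1 T1] := lpF e e1.
  by apply: ub_le_sup; [exact: supE.2|eexists; last reflexivity].
(* Parallelogram identity: the mean of [Phi] at [l + sg] and [l - sg] exceeds [Phi l] by [d], which
   is at least [delta ^+ 2] because of the cell [i0], against the choice of [l]. *)
have := Phile 1; rewrite normr1 lexx => /(_ isT).
have := Phile (- 1); rewrite normrN1 lexx => /(_ isT).
rewrite !PhiE; set c := 2 * _; set d := \sum_i _ => h1 h2.
suff : delta ^+ 2 <= d by move: h1 h2 Phil; lra.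
rewrite /d (bigD1 i0) //= (@le_trans _ _ (sg (P i0) ^+ 2)) //; last first.
  by rewrite lerDl sumr_ge0 // => i _; exact: sqr_ge0.
rewrite -[leRHS]real_normK ?num_real // ler_pXn2r ?nnegrE ?(ltW delta0) //.
have -> : sg (P i0) = f i0 * mB (P i0).
  rewrite /sg (bigD1 i0) //= setIid big1 ?addr0 // => i ii0.
  rewrite (_ : _ `&` _ = set0) ?(finadd_set0 fm) ?mulr0 //.
  apply/seteqP; split=> // x [Px Px'].
  by move: ii0; rewrite (Pdisj _ _ _ Px Px') eqxx.
by rewrite normrM fi0 mul1r ger0_norm ?fm.1 //; move: i0J; rewrite inE.
Unshelve. all: by end_near. Qed.

End Tight.

(** * Contents by words *)

Lemma esum_leP (R : realType) (T : choiceType) (L : set T) (f : T -> R) (c : R) :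
  (forall u, 0 <= f u) ->
  (\esum_(u in L) (f u)%:E <= c%:E)%E <->
  (forall A : {fset T}, [set` A] `<=` L -> \sum_(u <- A) f u <= c).
Proof.
move=> f0; split=> [Lc A AL|H].
  rewrite -lee_fin (le_trans _ Lc) // -sumEFin; apply: esum_ge.
  exists [set` A]; first by split.
  by rewrite fsbig_finite //= set_fsetK.
apply: ge_ereal_sup => _ [A [finA AL] <-].
rewrite fsbig_finite //= sumEFin lee_fin; apply: H.
by rewrite fset_setK.
Qed.

Section Cheap.
Variables (R : realType) (G : groupType) (X : topologicalType).
Variables (act : G -> X -> X) (F : nat -> {fset G}).
Local Notation word := {fmap G -> set X}.
Implicit Types (U V : set (set X)) (K : set X) (u : word).

Definition deep_words U N : set word := \bigcup_(j >= N) words U (F j).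

Definition weight (s : R) u : R := expR (- (s * (word_len u)%:R)).

(** Real-valued substitute for [bowen_pre <= c]: the sum is bounded through its finite subsums, and
    a family realizing the bound is demanded instead of an infimum. *)
Definition cheap K U N s (c : R) : Prop :=
  exists L : set word, [/\ L `<=` deep_words U N,
    K `<=` \bigcup_(u in L) word_set act u &
    forall A : {fset word}, [set` A] `<=` L -> \sum_(u <- A) weight s u <= c].

Definition null K U s : Prop := forall N eps, 0 < eps -> cheap K U N s eps.

Lemma weight_ge0 s u : 0 <= weight s u. Proof. exact: expR_ge0. Qed.

Lemma deep_wordsS U N M : (N <= M)%N -> deep_words U M `<=` deep_words U N.
Proof. by move=> NM u [j /= Mj uj]; exists j => //=; exact: leq_trans Mj. Qed.

Lemma bowen_pre_le K U N s c :
  cheap K U N s c -> (bowen_pre act F K U N s <= c%:E)%E.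
Proof.
move=> [L [LD KL Lc]]; apply: (@le_trans _ _ (\esum_(u in L) (weight s u)%:E)).
  by apply: ereal_inf_lbound; exists L.
by apply/esum_leP => // u; exact: weight_ge0.
Qed.

Lemma cheap_bowen_pre K U N s c :
  (bowen_pre act F K U N s < c%:E)%E -> cheap K U N s c.
Proof.
move=> /ereal_inf_lt [_ [L [LD KL] <-]] /ltW Lc; exists L; split=> //.
by apply/(@esum_leP _ _ _ (weight s)) => // u; exact: weight_ge0.
Qed.

Lemma bowen_pre_ge0 K U N (s : R) : (0 <= bowen_pre act F K U N s)%E.
Proof.
apply: le_ereal_inf_tmp => _ [L _ <-]; apply: esum_ge0 => u _.
by rewrite lee_fin expR_ge0.
Qed.

Lemma cheapW K K' U N N' s s' c c' : K' `<=` K -> (N' <= N)%N -> s <= s' ->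
  c <= c' -> cheap K U N s c -> cheap K' U N' s' c'.
Proof.
move=> KK' NN' ss' cc' [L [LD KL Lc]]; exists L; split.
- exact: subset_trans (deep_wordsS NN').
- exact: subset_trans KL.
- move=> A AL; apply: le_trans cc'; apply: le_trans (Lc A AL).
  by apply: ler_sum => u _; rewrite ler_expR lerN2 ler_wpM2r.
Qed.

Lemma nullW K K' U s s' : K' `<=` K -> s <= s' -> null K U s -> null K' U s'.
Proof. by move=> KK' ss' H N e e0; exact: cheapW (H N e e0). Qed.

(** [bowen_pre] is nondecreasing in [N], so its limit is a supremum and vanishes exactly when every
    term does. *)
Lemma bowen_measure_eq0 K U (s : R) : bowen_measure act F K U s = 0%E <-> null K U s.
Proof.
have nd : nondecreasing_seq (fun N => bowen_pre act F K U N s).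
  move=> N M NM; apply: le_ereal_inf => _ [L [LD KL] <-].
  by exists L => //; split=> //; apply: subset_trans (deep_wordsS NM).
have E : bowen_measure act F K U s =
    ereal_sup (range (fun N => bowen_pre act F K U N s)).
  by apply/cvg_lim => //; exact: ereal_nondecreasing_cvgn.
rewrite E; split=> [E0 N e e0|H].
  apply: cheap_bowen_pre; apply: (@le_lt_trans _ _ 0%E); last by rewrite lte_fin.
  by rewrite -E0; apply: ereal_sup_ubound; exists N.
apply/eqP; rewrite eq_le; apply/andP; split.
  apply: ge_ereal_sup => _ [N _ <-]; apply/lee_addgt0Pr => e e0.
  by rewrite add0e; apply: bowen_pre_le; exact: H.
by apply: (le_trans (bowen_pre_ge0 K U 0 s)); apply: ereal_sup_ubound; exists 0%N.
Qed.

Lemma bowen_entropy_cover_le K U (s : R) : 0 <= s -> null K U s ->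
  (bowen_entropy_cover R act F K U <= s%:E)%E.
Proof.
move=> s0 Ks; apply: ereal_inf_lbound; exists s => //; split=> //.
exact/bowen_measure_eq0.
Qed.

Lemma bowen_entropy_cover_lt K U (s : R) :
  (bowen_entropy_cover R act F K U < s%:E)%E -> null K U s.
Proof.
move=> /ereal_inf_lt [_ [s' [s'0 /bowen_measure_eq0 H] <-]].
by rewrite lte_fin => /ltW ss'; exact: nullW H.
Qed.

Lemma bowen_entropy_cover_ge0 K U : (0 <= bowen_entropy_cover R act F K U)%E.
Proof. by apply: le_ereal_inf_tmp => _ [s [s0 _] <-]; rewrite lee_fin. Qed.

Lemma sum_geometric_half (e : R) : 0 <= e -> forall n,
  \sum_(i < n) e / 2 ^+ i.+1 <= e.
Proof.
move=> e0 n; suff -> : \sum_(i < n) e / 2 ^+ i.+1 = e - e / 2 ^+ n.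
  by rewrite gerBl divr_ge0 // exprn_ge0.
elim: n => [|n IH]; first by rewrite big_ord0 expr0 divr1 subrr.
by rewrite big_ord_recr /= IH exprS; field; rewrite expf_neq0.
Qed.

(** A finite family of words from the union of the [L i] already lies in finitely many of them, so
    only partial sums of the costs are needed. *)
Lemma cheap_bigcup (Ki : nat -> set X) U N s (c : nat -> R) (C : R) :
  (forall i, cheap (Ki i) U N s (c i)) ->
  (forall n, \sum_(i < n) c i <= C) ->
  cheap (\bigcup_i Ki i) U N s C.
Proof.
move=> Kc cC; pose L i := sval (cid (Kc i)); have LP i := svalP (cid (Kc i)).
exists (\bigcup_i L i); split.
- by move=> u [i _]; case: (LP i) => + _ _; exact.
- move=> x [i _ Kx]; have [_ /(_ _ Kx) [u Lu xu] _] := LP i.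
  by exists u => //; exists i.
move=> A AL.
have [n An] : exists n, forall u, u \in A -> exists2 i, (i < n)%N & L i u.
  have H (u : A) : exists i, L i (val u).
    by have [i _ Li] := AL _ (valP u); exists i.
  pose f (u : A) := sval (cid (H u)); have fP (u : A) := svalP (cid (H u)).
  exists (\max_u f u).+1 => u uA; exists (f [` uA]%fset).
    by rewrite ltnS; exact: leq_bigmax.
  exact: fP [` uA]%fset.
apply: le_trans (cC n).
apply: (@le_trans _ _ (\sum_(i < n) \sum_(u <- A | u \in L i) weight s u)).
  rewrite (exchange_big_dep xpredT) //= big_seq [leRHS]big_seq.
  apply: ler_sum => u uA; have [i ni Li] := An u uA.
  rewrite (bigD1 (Ordinal ni)) /=; last exact: mem_set.
  by rewrite lerDl sumr_ge0 // => j _; exact: weight_ge0.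
apply: ler_sum => i _; have [_ _ H] := LP i.
rewrite (_ : \sum_(u <- A | _) _ = \sum_(u <- [fset u in A | u \in L i]%fset) weight s u).
  apply: H => u /=; rewrite !inE => /andP[_]; exact: set_mem.
by rewrite big_fset /=.
Qed.

Lemma null_bigcup (Ki : nat -> set X) U s :
  (forall i, null (Ki i) U s) -> null (\bigcup_i Ki i) U s.
Proof.
move=> Kn N e e0; apply: (@cheap_bigcup _ _ _ _ (fun i => e / 2 ^+ i.+1)).
  by move=> i; apply: Kn; rewrite divr_gt0 // exprn_gt0.
by apply: sum_geometric_half; exact: ltW.
Qed.

Lemma cheapU K K' U N s c c' : cheap K U N s c -> cheap K' U N s c' ->
  cheap (K `|` K') U N s (c + c').
Proof.
move=> [L [LD KL Lc]] [L' [LD' KL' Lc']]; exists (L `|` L'); split.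
- by move=> u [/LD|/LD'].
- by move=> x [/KL|/KL'] [u Lu xu]; exists u => //; [left|right].
move=> A AL.
rewrite (bigID (mem L)) /=; apply: lerD; rewrite big_fset_condE.
  by apply: Lc => u /=; rewrite !inE => /andP[_] /set_mem.
apply: Lc' => u /=; rewrite !inE => /andP[/AL[Lu|//]] /negP[]; exact: mem_set.
Qed.

End Cheap.

(** * Growth of the Følner sets; length and depth of words *)

Section Growth.
Variables (R : realType) (G : groupType) (F : nat -> {fset G}).
Hypothesis G_infinite : infinite_set [set: G].
Hypothesis F_folner : folner R F.
Hypothesis F_incr : forall n, (F n `<=` F n.+1)%fset.

Lemma fsubset_homo n m : (n <= m)%N -> (F n `<=` F m)%fset.
Proof.
move=> nm; rewrite -(subnK nm); elim: (m - n)%N => [|k IH]; first by rewrite add0n.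
by rewrite addSn (fsubset_trans IH).
Qed.

Lemma symdiff_ltrans_lt (s : G) (e : R) : 0 < e -> \forall n \near \oo,
  (#|` symdiff (F n) (ltrans s (F n))|%:R < e * #|` F n|%:R :> R).
Proof.
move=> e0; have [F0 Fs] := F_folner.
have H := @cvgr0_norm_lt _ _ _ _ _ _ (Fs s) _ e0.
near=> n; have Fn0 : 0 < #|` F n|%:R :> R by rewrite ltr0n cardfs_gt0.
have : `|#|` symdiff (F n) (ltrans s (F n))|%:R / #|` F n|%:R| < e. near: n; exact: H.
by rewrite ger0_norm ?divr_ge0 // ltr_pdivrMr.
Unshelve. all: by end_near. Qed.

(** With bounded cardinalities the nested sets would stabilize at some [F n0]. A symmetric
    difference of proportion below [#|F n0|^-1] is empty, so [F n0] would be invariant under all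
    translations, hence equal to the infinite group. *)
Lemma card_folner_unbounded m : exists N, forall n, (N <= n)%N -> (m <= #|` F n|)%N.
Proof.
suff [N mN] : exists N, (m <= #|` F N|)%N.
  by exists N => n Nn; apply: (leq_trans mN); exact/fsubset_leq_card/fsubset_homo.
apply: contrapT => /forallNP H.
have {}H n : (#|` F n| < m)%N by rewrite ltnNge; apply/negP/H.
have ex : exists k, `[< exists n, #|` F n| = k >] by exists #|` F 0|; apply/asboolP; exists 0%N.
have ub k : `[< exists n, #|` F n| = k >] -> (k <= m)%N.
  by move=> /asboolP [n <-]; exact: ltnW.
case: (ex_maxnP ex ub) => k /asboolP [n0 n0k] kmax.
have Fn n : (n0 <= n)%N -> F n = F n0.
  move=> nn0; apply/esym/eqP; rewrite eqEfcard fsubset_homo // n0k.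
  by apply: kmax; apply/asboolP; exists n.
have [F0 _] := F_folner.
have /fset0Pn [x xF] := F0 n0.
apply: G_infinite; rewrite (_ : setT = [set` F n0]); first exact: finite_fset.
apply/seteqP; split=> // g _ /=.
have c0 : 0 < #|` F n0|%:R :> R by rewrite ltr0n cardfs_gt0.
have e0 : 0 < #|` F n0|%:R^-1 :> R by rewrite invr_gt0.
have [n1 _ n1P] := symdiff_ltrans_lt (g * x^-1)%g e0.
have := n1P (maxn n0 n1) (leq_maxr _ _); rewrite Fn ?leq_maxl //.
rewrite mulVf ?gt_eqF // (ltr_nat _ _ 1) ltnS leqn0 cardfs_eq0 fsetU_eq0 => /andP[_ /eqP E].
have : g \in ltrans (g * x^-1)%g (F n0).
  by apply/imfsetP; exists x => //; rewrite mulgVK.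
apply: contraTT => gF; apply/negP => gs.
have : g \in (ltrans (g * x^-1)%g (F n0) `\` F n0)%fset by rewrite inE gF.
by rewrite E inE.
Qed.

End Growth.

Section WordFacts.
Variables (R : realType) (G : groupType) (X : topologicalType).
Variables (act : G -> X -> X) (F : nat -> {fset G}).
Hypothesis F_incr : forall n, (F n `<=` F n.+1)%fset.
Hypothesis F_unbounded : forall m, exists N, forall n, (N <= n)%N -> (m <= #|` F n|)%N.
Local Notation word := {fmap G -> set X}.
Local Notation D := (@deep_words G X F).
Implicit Types (U V : set (set X)) (u : word).

Lemma deep_words_long m : exists N, forall U u, D U N u -> (m <= word_len u)%N.
Proof.
by have [N H] := F_unbounded m; exists N => U u [j Nj [uj _]]; rewrite /word_len uj H.
Qed.

(** An index [j] below [N] is possible; then [F j] has at least as many elements as the larger set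
    [F N], so they coincide and the word also counts at depth [N]. *)
Lemma long_words_deep N : exists m, forall U u, D U 0 u -> (m <= word_len u)%N -> D U N u.
Proof.
exists #|` F N| => U u [j _ [uj Uu]]; rewrite /word_len uj => Nj.
have [Nlej|/ltnW jN] := leqP N j; first by exists j.
exists N => /=; first exact: leqnn.
split=> //; rewrite uj; apply/eqP.
by rewrite eqEfcard Nj (fsubset_homo F_incr).
Qed.

(** Nested finite sets of the same cardinality are equal. This makes words of one length comparable
    letter by letter. *)
Lemma domf_word_len U V N M u v : D U N u -> D V M v ->
  word_len u = word_len v -> domf u = domf v.
Proof.
move=> [i _ [ui _]] [j _ [vj _]]; rewrite /word_len ui vj => E.
have [ij|/ltnW ij] := leqP i j.
  by apply/eqP; rewrite eqEfcard E leqnn (fsubset_homo F_incr).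
by apply/esym/eqP; rewrite eqEfcard E leqnn (fsubset_homo F_incr).
Qed.

Definition mkword (E : {fset G}) (c : G -> set X) : word :=
  [fmap g : E => c (val g)].

Lemma word_set_mkword E c :
  word_set act (mkword E c) = \bigcap_(g in [set` E]) (act g @^-1` c g).
Proof.
apply/seteqP; split=> x H g.
  by move=> gE; have := H [` gE]%fset I; rewrite /= ffunE.
by move=> _; rewrite /= ffunE; apply: H; exact: valP.
Qed.

Lemma words_mkword U E c : (forall g, g \in E -> U (c g)) -> words U E (mkword E c).
Proof. by move=> Uc; split=> // g; rewrite ffunE; apply: Uc; exact: valP. Qed.

Lemma word_setE U E u : words U E u -> exists2 c : G -> set X,
  (forall g, g \in E -> U (c g)) &
  word_set act u = \bigcap_(g in [set` E]) (act g @^-1` c g).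
Proof.
move=> [uE Uu]; subst E; exists (fun g => odflt set0 u.[? g]%fmap).
  by move=> g gu; rewrite in_fnd; exact: Uu.
apply/seteqP; split=> x H g.
  by move=> gu /=; rewrite in_fnd; exact: H.
by move=> _; have := H (val g) (valP g); rewrite /= in_fnd fsetsubE.
Qed.

Lemma finite_words U (E : {fset G}) : finite_set U -> finite_set (words U E).
Proof.
move=> finU.
pose f (w : {ffun E -> fset_set U}) : word := [fmap g : E => val (w g)].
suff : words U E `<=` f @` [set` (predT : pred {ffun E -> fset_set U})].
  by move/sub_finite_set; apply; exact/finite_image/(@finite_finpred _ _ predT).
move=> u [uE Uu]; subst E.
have uU (g : domf u) : u g \in fset_set U by rewrite in_fset_set // mem_set.
exists [ffun g => [` uU g]%fset] => //.
apply/fmapP => g; rewrite /f; case: fndP => gu; last by rewrite not_fnd.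
by rewrite in_fnd !ffunE.
Qed.

Lemma finite_short_words U m : finite_set U ->
  finite_set [set u | D U 0 u /\ (word_len u <= m)%N].
Proof.
move=> finU; have [N H] := F_unbounded m.+1.
apply: (@sub_finite_set _ _ (\bigcup_(j in `I_N) words U (F j))).
  move=> u [[j _ uj] um]; exists j => //=; rewrite ltnNge; apply/negP => Nj.
  by have := H _ Nj; rewrite -uj.1 ltnNge um.
by apply: bigcup_finite => // j _; exact: finite_words.
Qed.

Definition short_words U N m : {fset word} :=
  fset_set [set u | D U N u /\ (word_len u <= m)%N].

Lemma in_short_words U N m u : finite_set U ->
  u \in short_words U N m <-> D U N u /\ (word_len u <= m)%N.
Proof.
move=> finU; rewrite in_fset_set.
  by split=> [/set_mem|/mem_set].
apply: sub_finite_set (finite_short_words m finU) => v [vN vm]; split=> //.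
exact: deep_wordsS vN.
Qed.

Lemma finite_cover_member U (x : X) : finite_open_cover U -> exists2 A, U A & A x.
Proof. by move=> [_ _ Ucov]; have : [set: X] x by []; rewrite -Ucov. Qed.

Lemma word_cover U E : finite_open_cover U ->
  [set: X] `<=` \bigcup_(u in words U E) word_set act u.
Proof.
move=> covU x _; pose c g := sval (cid2 (finite_cover_member (act g x) covU)).
have cP g : U (c g) /\ c g (act g x) by rewrite /c; case: cid2.
exists (mkword E c); first by apply: words_mkword => g _; case: (cP g).
by rewrite word_set_mkword => g _; case: (cP g).
Qed.

Lemma word_set_open U E u : (forall g, continuous (act g)) ->
  (forall A, U A -> open A) -> words U E u -> open (word_set act u).
Proof.
move=> actC Uo /word_setE [c Uc ->].
rewrite openE => x H; apply: filter_bigI => g gE.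
apply: actC; apply: open_nbhs_nbhs; split; last exact: H.
exact/Uo/Uc.
Qed.

End WordFacts.

(** * Reduction of Souslin sets to compact sets *)

Lemma expRN_small (R : realType) (c d e : R) : 0 < d -> 0 < e ->
  exists m : nat, c * expR (- (d * m%:R)) <= e.
Proof.
move=> d0 e0; pose m := (Num.truncn (c / (e * d))).+1; exists m.
have cm : c < m%:R * (e * d) by rewrite -ltr_pdivrMr ?mulr_gt0 // truncnS_gt.
rewrite expRN -ler_pdivlMr ?invr_gt0 ?expR_gt0 // invrK.
apply: le_trans (_ : e * (1 + d * m%:R) <= _); first by move: cm; nra.
by rewrite ler_wpM2l ?expR_ge1Dx // ltW.
Qed.

Section Increasing.
Variables (R : realType) (G : groupType) (X : topologicalType).
Variables (act : G -> X -> X) (F : nat -> {fset G}).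
Hypothesis F_incr : forall n, (F n `<=` F n.+1)%fset.
Hypothesis F_unbounded : forall m, exists N, forall n, (N <= n)%N -> (m <= #|` F n|)%N.
Variable U : set (set X).
Local Notation word := {fmap G -> set X}.
Local Notation D := (@deep_words G X F).
Implicit Types (K : set X) (u : word) (s c : R).

(** On words of length at least [m] the larger exponent gains a factor [expR (- (s' - s) m)], so a
    cost merely bounded at all depths becomes arbitrarily small. *)
Lemma cheap_null K s s' c : s < s' ->
  (forall N, cheap act F K U N s c) -> null act F K U s'.
Proof.
move=> ss' Kc N e e0.
have d0 : 0 < s' - s by rewrite subr_gt0.
have [m cm] := expRN_small c d0 e0.
have [N' Nlen] := @deep_words_long G X F F_unbounded m.
have [L [LD KL Lc]] := Kc (maxn N N').
exists L; split=> //.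
  by apply: subset_trans LD _; apply: deep_wordsS; exact: leq_maxl.
move=> A AL; apply: le_trans cm.
apply: (@le_trans _ _ (\sum_(u <- A) weight s u * expR (- ((s' - s) * m%:R)))).
  rewrite big_seq [leRHS]big_seq; apply: ler_sum => u uA.
  rewrite /weight -expRD ler_expR -opprD lerN2.
  have : m%:R <= (word_len u)%:R :> R.
    by rewrite ler_nat; apply: (Nlen U); apply: deep_wordsS (LD _ (AL _ uA));
      exact: leq_maxr.
  by move: d0 => /[swap]; nra.
by rewrite -mulr_suml ler_wpM2r ?expR_ge0 // Lc.
Qed.

(* The families covering E n have an ultralimit Lam. Whatever part of E m it
   misses is covered by arbitrarily deep words at bounded cost, hence is null for
   every larger exponent. *)
Lemma cheap_increasing (E : nat -> set X) N s s' c e : finite_set U ->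
  (forall n m, (n <= m)%N -> E n `<=` E m) -> s < s' -> 0 < e ->
  (forall n, cheap act F (E n) U N s c) ->
  cheap act F (\bigcup_n E n) U N s' (c + e).
Proof.
move=> finU Emono ss' e0 Ec.
have [UF [UU ooU]] := ultraFilterLemma (@eventually_filter).
have FU : ProperFilter UF := @ultra_proper _ UF UU.
pose L n := sval (cid (Ec n)); have LP n := svalP (cid (Ec n)).
pose Lam := [set u | D U N u /\ UF [set n | L n u]].
have Lamc : cheap act F (\bigcup_(u in Lam) word_set act u) U N s' c.
  exists Lam; split=> // [u [] //|A AL].
  have : UF (\bigcap_(u in [set` A]) [set n | L n u]).
    by apply: filter_bigI => u uA; case: (AL _ uA).
  move=> /filter_ex [n nA]; have [_ _ Lc] := LP n.
  apply: le_trans (Lc A _); last by move=> u uA; exact: nA.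
  by apply: ler_sum => u _; rewrite ler_expR lerN2 ler_wpM2r // ltW.
have Em m : null act F (E m `\` \bigcup_(u in Lam) word_set act u) U s'.
  apply: (@cheap_null _ s s' c) => // N'.
  have [M NM] := @long_words_deep G X F F_incr N'.
  (* Only finitely many words have length at most [M], so some [L n] with [m <= n] has none of them
     outside [Lam]. A point of [E m] missed by [Lam] is then covered by a longer word of [L n],
     which has depth [N']. *)
  have : UF (\bigcap_(u in [set` short_words F U N M])
      [set n | (m <= n)%N /\ (L n u -> Lam u)]).
    apply: filter_bigI => u /in_short_words - /(_ F_unbounded finU) [Du _].
    have Um : UF [set n | (m <= n)%N] by apply: ooU; exists m.
    have [Lu|Lu] := in_ultra_setVsetC [set n | L n u] UU.
      by apply: filterS Um => n /= mn; split.
    by apply: filterS (filterI Um Lu) => n /= [mn nL].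
  have Um : UF [set n | (m <= n)%N] by apply: ooU; exists m.
  move=> /(filterI Um) /filter_ex [n [/= mn nS]]; have [LD EL Lc] := LP n.
  exists (L n `&` D U N'); split=> [u []//|x [Ex xL]|A AL].
    have [u Lu xu] := EL _ (Emono _ _ mn _ Ex); exists u => //; split=> //.
    apply: NM; first by apply: deep_wordsS (LD _ Lu).
    rewrite leqNgt; apply/negP => /ltnW uM; apply: xL; exists u => //.
    by apply: (nS u _).2 => //; apply/in_short_words => //; split=> //; exact: LD.
  by apply: Lc => u /AL [].
have Enull := null_bigcup Em.
apply: cheapW (cheapU Lamc (Enull N e e0)) => // x [n _ Enx].
have [xL|xL] := pselect ((\bigcup_(u in Lam) word_set act u) x); first by left.
by right; exists n.
Qed.

End Increasing.

Section Souslin.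
Variables (X : topologicalType).
Local Notation baire := (prod_topology (fun _ : nat => nat)).
Implicit Types (b : nat -> nat).

Definition bounded_by b (m : nat) : set baire :=
  [set w | forall i, (i < m)%N -> (w i <= b i)%N].

Definition bounded_all b : set baire := [set w | forall i, (w i <= b i)%N].

Lemma compact_bounded_all b : compact (bounded_all b).
Proof.
apply: (@tychonoff nat (fun=> nat) (fun i => [set n | (n <= b i)%N])) => i.
apply: finite_compact; apply: (@sub_finite_set _ _ `I_((b i).+1)) => // n /=.
Qed.

(** If each cylinder contained some [w m] outside [O], a cluster point of the [w m] would be bounded
    by [b] in every coordinate and still lie outside [O]. *)
Lemma bounded_all_open b (O : set baire) : open O -> bounded_all b `<=` O ->
  exists m, bounded_by b m `<=` O.
Proof.
move=> openO bO; apply: contrapT => /forallNP H.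
have {}H m : exists w, bounded_by b m w /\ ~ O w.
  have /existsNP [w /not_implyP ?] := H m; by exists w.
pose w m := sval (cid (H m)); have wP m := svalP (cid (H m)).
(* At coordinate [i] the bound [b i] holds for [w m] as soon as [i < m]; the finitely many
   exceptions [m <= i] enter through the maximum, and all [w m] lie in one compact set. *)
pose b' i := maxn (b i) (\max_(m < i.+1) w m i).
have wb' m : bounded_all b' (w m).
  move=> i; rewrite leq_max; have [mi|im] := leqP m i.
    by rewrite (leq_bigmax (Ordinal (mi : (m < i.+1)%N))) orbT.
  by rewrite (wP m).1.
have FC : (w @ \oo) (bounded_all b') by exists 0%N => // m _; exact: wb'.
have [z [_ zc]] := @compact_bounded_all b' (w @ \oo) _ FC.
have clo (A : set baire) : closed A -> (\forall m \near \oo, A (w m)) -> A z.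
  move=> cA Aw; apply: cA => V Vz; exact: (zc A V Aw Vz).
have zO : (~` O) z.
  by apply: clo; [rewrite closedC|near=> m; exact: (wP m).2].
apply/zO/bO => i; apply: (clo [set w' : baire | (w' i <= b i)%N]).
  pose pr : baire -> nat := fun w => w i.
  have prc : continuous pr := @proj_continuous nat (fun=> nat) i.
  exact: iffLR (continuous_closedP pr) prc [set n | (n <= b i)%N] (discrete_closed _).
by exists i.+1 => // m /= im; exact: (wP m).1.
Unshelve. all: by end_near. Qed.

End Souslin.

Lemma dependent_chain (T : Type) (inv : nat -> T -> Prop)
    (rel : nat -> T -> T -> Prop) (x0 : T) : inv 0%N x0 ->
  (forall n x, inv n x -> exists y, inv n.+1 y /\ rel n x y) ->
  exists f : nat -> T, forall n, inv n (f n) /\ rel n (f n) (f n.+1).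
Proof.
move=> inv0 step.
have next n x : exists y, inv n x -> inv n.+1 y /\ rel n x y.
  by have [/step [y ?]|?] := pselect (inv n x); [exists y|exists x].
pose nx n x := sval (cid (next n x)); have nxP n x := svalP (cid (next n x)).
pose f := fix f n := if n is m.+1 then nx m (f m) else x0.
have fP n : inv n (f n) by elim: n => //= n IH; exact: (nxP n _ IH).1.
by exists f => n; split=> //; exact: (nxP n _ (fP n)).2.
Qed.

Section SouslinCapacity.
Variables (R : realType) (G : groupType) (X : topologicalType).
Variables (act : G -> X -> X) (F : nat -> {fset G}).
Hypothesis F_incr : forall n, (F n `<=` F n.+1)%fset.
Hypothesis F_unbounded : forall m, exists N, forall n, (N <= n)%N -> (m <= #|` F n|)%N.
Hypothesis act_cont : forall g, continuous (act g).

Lemma halving_lt (x y : R) (m : nat) : x < y ->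
  x + (y - x) / 2 ^+ m.+1 < x + (y - x) / 2 ^+ m.
Proof.
move=> xy; rewrite ltrD2l ltr_pM2l ?subr_gt0 // ltf_pV2 ?posrE ?exprn_gt0 //.
by rewrite ltr_eXn2l // ltr1n.
Qed.

(** A capacity argument. The coordinates of the Baire space are bounded one at a time: the sets
    obtained from larger and larger bounds at coordinate [m] increase to the previous one, so one of
    them is still not cheap. A cheap family covering the compact image would, being open, cover the
    image of some cylinder as well. *)
Lemma souslin_compact (U : set (set X)) K N (s s' c c' : R) :
  finite_set U -> (forall A, U A -> open A) -> souslin K ->
  s' < s -> 0 <= c' -> c' < c -> ~ cheap act F K U N s c ->
  exists K', [/\ K' `<=` K, compact K' & ~ cheap act F K' U N s' c'].
Proof.
move=> finU openU souK ss' c'0 cc' nK.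
case: souK => [K0|[f [fc fK]]].
  exfalso; apply: nK; rewrite K0; exists set0; split=> // A A0.
  rewrite big_seq big_pred0 ?(le_trans c'0) ?ltW // => u.
  by apply/negbTE/negP => uA; exact: (A0 u uA).
(* Exponent and cost go down from [s] and [c] towards [s'] and [c'] without reaching them, leaving
   room for the loss in [cheap_increasing] at each coordinate. *)
pose sm m : R := s' + (s - s') / 2 ^+ m; pose cm m : R := c' + (c - c') / 2 ^+ m.
pose bad m (b : nat -> nat) := ~ cheap act F (f @` bounded_by b m) U N (sm m) (cm m).
have step m b : bad m b -> exists k, bad m.+1 (fun i => if (i < m)%N then b i else k).
  move=> bb; apply: contrapT => /forallNP H; apply: bb.
  pose E k := f @` bounded_by (fun i => if (i < m)%N then b i else k) m.+1.
  have {}H k : cheap act F (E k) U N (sm m.+1) (cm m.+1) by exact: contrapT (H k).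
  have c0 : 0 < cm m - cm m.+1 by rewrite subr_gt0 halving_lt.
  have Emono k l : (k <= l)%N -> E k `<=` E l.
    move=> kl _ [w bw <-]; exists w => // i im.
    by apply: leq_trans (bw i im) _; case: ifP.
  have := cheap_increasing F_incr F_unbounded finU Emono (halving_lt m ss') c0 H.
  rewrite (_ : cm m.+1 + _ = cm m); last by ring.
  apply: cheapW => //.
  move=> _ [w bw <-]; exists (w m) => //; exists w => // i im /=.
  case: ifP => [|/negbT]; first exact: bw.
  by rewrite -leqNgt => mi; have -> : i = m by apply/eqP; rewrite eqn_leq mi andbT.
have [b0 b0P] : exists b, bad 0%N b.
  exists (fun=> 0%N); apply: contra_not nK; rewrite /sm /cm expr0 !divr1.
  rewrite !subrKC; apply: cheapW => //; rewrite -fK => _ [w _ <-].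
  by exists w.
pose agree m (b b' : nat -> nat) := forall i, (i < m)%N -> b' i = b i.
have [m b1 /step [k bk]|p pP] := @dependent_chain _ bad agree b0 b0P.
  by eexists; split; [exact: bk|move=> i /= ->].
have pE n i : (i < n)%N -> p n i = p i.+1 i.
  elim: n => // n IH; rewrite ltnS leq_eqVlt => /orP[/eqP -> //|ni].
  by rewrite -IH //; exact: (pP n).2.
pose b i := p i.+1 i.
have bP n : bad n b.
  have := (pP n).1; apply: contra_not; apply: cheapW => //.
  by move=> _ [w bw <-]; exists w => // i ni; rewrite /b -(pE n) ?bw.
exists (f @` bounded_all b); split.
- by rewrite -fK => _ [w _ <-]; exists w.
- apply: continuous_compact; last exact: compact_bounded_all.
  exact: continuous_subspaceT.
move=> [L [LD KL Lc]].
have oL : open (f @^-1` (\bigcup_(u in L) word_set act u)).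
  apply: open_comp => [w _|]; first exact: fc.
  apply: bigcup_open => u Lu; have [j _ uj] := LD _ Lu.
  exact: word_set_open uj.
have [|m bm] := bounded_all_open (b := b) oL; first by move=> w bw; apply: KL; exists w.
apply: (bP m); apply: (@cheapW _ _ _ _ _ _ _ _ N N s' _ c' _ _ _ _ _).
- exact: subset_refl.
- exact: leqnn.
- by rewrite lerDl divr_ge0 ?exprn_ge0 // subr_ge0 ltW.
- by rewrite lerDl divr_ge0 ?exprn_ge0 // subr_ge0 ltW.
by exists L; split=> // _ [w bw <-]; exact: bm.
Qed.

End SouslinCapacity.

(** * Frostman functionals *)

Lemma ler_sum_subseq (R : realDomainType) (T : choiceType) (s t : seq T) (f : T -> R) :
  (forall u, 0 <= f u) -> uniq s -> {subset s <= t} ->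
  \sum_(u <- s) f u <= \sum_(u <- t) f u.
Proof.
move=> f0; elim: s t => [|u s IH] t /=; first by rewrite big_nil sumr_ge0.
move=> /andP[us uniqs] st; have ut : u \in t by apply: st; rewrite inE eqxx.
rewrite big_cons (big_rem u ut) /= lerD2l; apply: IH => // v vs.
have := st v; rewrite inE vs orbT => /(_ isT).
by rewrite (perm_mem (perm_to_rem ut)) inE => /orP[/eqP vu|//]; rewrite -vu vs in us.
Qed.

(** Each chosen point discards the words through it, of total weight above [th], and does not affect
    the weight at points that share no word with it; the recursion goes on with those. *)
Lemma greedy_points (R : realType) (X : choiceType) (T : choiceType)
    (S : T -> set X) (g : T -> R) (th : R) (Gam : {fset T}) (Y : set X) :
  0 <= th -> (forall u, 0 <= g u) ->
  (forall y, Y y -> th < \sum_(u <- Gam) g u * \1_(S u) y) ->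
  exists xs : seq X, (size xs)%:R * th <= \sum_(u <- Gam) g u /\
    forall y, Y y -> exists x u, [/\ x \in xs, u \in Gam, S u x & S u y].
Proof.
move=> th0 g0; have [n] := ubnP #|` Gam|.
elim: n Gam Y => // n IH Gam Y Gn HY.
have [[x Yx]|Y0] := pselect (exists x, Y x); last first.
  exists [::]; split; first by rewrite mul0r sumr_ge0.
  by move=> y Yy; exfalso; apply: Y0; exists y.
pose Gam' := [fset u in Gam | x \notin S u]%fset.
pose Y' := [set y | Y y /\ forall u, u \in Gam -> S u x -> ~ S u y].
have sumE (f : T -> R) : \sum_(u <- Gam) f u =
    \sum_(u <- Gam') f u + \sum_(u <- Gam | x \in S u) f u.
  by rewrite (bigID (fun u => x \in S u)) /= addrC -big_fset_condE.
have ltG : (#|` Gam'| < n)%N.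
  rewrite -ltnS; apply: leq_ltn_trans Gn.
  rewrite ltn_neqAle fsubset_leq_card ?andbT; last first.
    by apply/fsubsetP => u; rewrite !inE => /andP[].
  apply/negP => /eqP E.
  have GG : Gam' = Gam.
    apply/eqP; rewrite eqEfcard E leqnn andbT.
    by apply/fsubsetP => u; rewrite !inE => /andP[].
  have := HY x Yx; rewrite big_seq big1 ?ltNge ?th0 // => u uG.
  have : u \in Gam' by rewrite GG.
  by rewrite !inE => /andP[_ /negbTE xu]; rewrite indicE xu mulr0.
have [|xs [szxs xsP]] := IH Gam' Y' ltG.
  move=> y [Yy yx]; have := HY y Yy; rewrite sumE.
  rewrite [X in _ + X]big_seq_cond [X in _ + X]big1 ?addr0 // => u /andP[uG /set_mem xu].
  rewrite indicE memNset ?mulr0 //; exact: yx.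
exists (x :: xs); split.
  rewrite /= -[_.+1%:R]natr1 mulrDl mul1r sumE lerD // (le_trans (ltW (HY x Yx))) //.
  rewrite sumE [X in X + _]big_seq [X in X + _]big1 ?add0r; last first.
    by move=> u; rewrite !inE => /andP[_ /negbTE xu]; rewrite indicE xu mulr0.
  by apply: ler_sum => u xu; rewrite indicE xu mulr1.
move=> y Yy; have [Y'y|nY'y] := pselect (Y' y).
  have [x' [u [x'xs uG' Sx' Sy]]] := xsP y Y'y.
  exists x', u; split=> //; first by rewrite inE x'xs orbT.
  by move: uG'; rewrite !inE => /andP[].
have [u [uG Sx Sy]] : exists u, [/\ u \in Gam, S u x & S u y].
  apply: contrapT => H; apply: nY'y; split=> // u uG Sx Sy.
  by apply: H; exists u.
by exists x, u; split=> //; rewrite inE eqxx.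
Qed.

Section FrostmanWords.
Variables (R : realType) (G : groupType) (X : topologicalType).
Variables (act : G -> X -> X) (F : nat -> {fset G}).
Hypothesis F_incr : forall n, (F n `<=` F n.+1)%fset.
Hypothesis F_unbounded : forall m, exists N, forall n, (N <= n)%N -> (m <= #|` F n|)%N.
Local Notation word := {fmap G -> set X}.
Local Notation D := (@deep_words G X F).
Local Notation S := (word_set act).
Implicit Types (U V : set (set X)) (K : set X) (u : word) (s : R).

Lemma cheap_seq U K N s (ws : seq word) (c : R) :
  (forall w, w \in ws -> D U N w) -> K `<=` \bigcup_(w in [set` ws]) S w ->
  \sum_(w <- ws) weight s w <= c -> cheap act F K U N s c.
Proof.
move=> wsD Kws wsc; exists [set` ws]; split=> // A Aws; apply: le_trans wsc.
by apply: ler_sum_subseq => // u; exact: weight_ge0.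
Qed.

Lemma geometric_sum_le (q : R) M : 0 <= q -> q < 1 ->
  (1 - q) * \sum_(m < M) q ^+ m <= 1.
Proof.
move=> q0 q1; rewrite -[X in X * _]opprB mulNr -subrX1 opprB.
by rewrite gerBl exprn_ge0.
Qed.

Lemma sum_by_length (Gam : {fset word}) (f : word -> R) M :
  (forall u, u \in Gam -> (word_len u < M)%N) ->
  \sum_(u <- Gam) f u =
  \sum_(m < M) \sum_(u <- [fset u in Gam | word_len u == m]%fset) f u.
Proof.
move=> GM; under [RHS]eq_bigr do rewrite -big_fset_condE.
rewrite (exchange_big_dep xpredT) //= big_seq [RHS]big_seq.
by apply: eq_bigr => u uG; rewrite (big_pred1 (Ordinal (GM u uG))).
Qed.

(** [V] is a barycentric refinement of [U]: the star of every point lies in a member of [U]. *)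
Definition star_points U V : Prop :=
  forall y, exists2 A, U A & forall B, V B -> B y -> B `<=` A.

(** The factor [1 - expR (- (s - s'))] normalizes the geometric series that shares out the total
    among the lengths; [c] is the cost that is not attained. *)
Definition frostman_const s s' c : R := (c * (1 - expR (- (s - s'))))^-1.

Lemma frostman_const_gt0 s s' c : 0 < c -> s' < s -> 0 < frostman_const s s' c.
Proof.
move=> c0 ss'; rewrite invr_gt0 mulr_gt0 // subr_gt0 -[ltRHS]expR0 ltr_expR.
by rewrite oppr_lt0 subr_gt0.
Qed.

(* A weighted cover charges some length m in proportion exp(- (s - s') m); points
   of which no two share a word of length m are then few, and their stars cover. *)
Lemma cheap_weights U V K N s s' c (Gam : {fset word}) (g : word -> R) :
  star_points U V -> 0 < c -> s' < s -> ~ cheap act F K U N s c ->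
  (forall u, 0 <= g u) -> (forall u, u \in Gam -> D V N u) ->
  exists2 x, K x & \sum_(u <- Gam) g u * \1_(S u) x <=
    \sum_(u <- Gam) g u * (frostman_const s s' c * weight s' u).
Proof.
move=> starUV c0 ss' nK g0 GD; apply: contrapT => H.
have {}H x : K x -> \sum_(u <- Gam) g u * (frostman_const s s' c * weight s' u)
    < \sum_(u <- Gam) g u * \1_(S u) x.
  by move=> Kx; rewrite ltNge; apply/negP => le; apply: H; exists x.
pose B := frostman_const s s' c; have B0 : 0 < B by exact: frostman_const_gt0.
pose Q := \sum_(u <- Gam) g u * weight s' u.
have BQ : \sum_(u <- Gam) g u * (B * weight s' u) = B * Q.
  by rewrite mulr_sumr; apply: eq_bigr => u _; ring.
pose M := (\max_(u <- Gam) word_len u).+1.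
have GM u : u \in Gam -> (word_len u < M)%N.
  by move=> uG; rewrite ltnS; exact: leq_bigmax_seq.
pose q := expR (- (s - s')); have q0 : 0 <= q by exact: expR_ge0.
have q1 : q < 1 by rewrite -[ltRHS]expR0 ltr_expR oppr_lt0 subr_gt0.
have qm m : q ^+ m = expR (- ((s - s') * m%:R)) by rewrite -expRM_natl mulrN mulrC.
pose Gm m := [fset u in Gam | word_len u == m]%fset.
(* The share of length [m]. The shares add up to at most [B * Q], so every point of [K] exceeds the
   share of some length. *)
pose th m := B * Q * ((1 - q) * q ^+ m).
have Q0 : 0 <= Q by apply: sumr_ge0 => u _; rewrite mulr_ge0 ?weight_ge0.
have [Q_eq0|Qneq0] := eqVneq Q 0.
  apply: nK; exists set0; split=> // [x Kx|A A0].
    have := H x Kx; rewrite BQ Q_eq0 mulr0 big_seq big1 ?ltxx // => u uG.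
    move/eqP : Q_eq0; rewrite psumr_eq0; last first.
      by move=> v _; rewrite mulr_ge0 ?weight_ge0.
    move=> /allP /(_ _ uG) /=; rewrite mulf_eq0 => /orP[/eqP ->|]; first by rewrite mul0r.
    by rewrite gt_eqF ?expR_gt0.
  rewrite big_seq big_pred0 ?ltW // => u.
  by apply/negbTE/negP => uA; exact: (A0 u uA).
have Qgt0 : 0 < Q by rewrite lt_def Qneq0.
have th0 m : 0 < th m.
  by rewrite mulr_gt0 ?mulr_gt0 // ?subr_gt0 // exprn_gt0 // expR_gt0.
pose Km m := [set x | K x /\ th m < \sum_(u <- Gm m) g u * \1_(S u) x].
pose cm m := (\sum_(u <- Gm m) g u) / th m * expR (- (s * m%:R)).
have KmU : K `<=` \bigcup_m Km m.
  move=> x Kx; apply: contrapT => nx; have := H x Kx; apply/negP; rewrite -leNgt BQ.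
  rewrite (sum_by_length _ GM) (@le_trans _ _ (\sum_(m < M) th m)) //.
    apply: ler_sum => m _; rewrite leNgt; apply/negP => lt; apply: nx.
    by exists m.
  rewrite /th -mulr_sumr -mulr_sumr ler_piMr ?mulr_ge0 ?(ltW B0) //.
  exact: geometric_sum_le.
apply: nK; apply: (@cheapW _ _ _ _ _ (\bigcup_m Km m) K U N N s s c c) => //.
apply: (@cheap_bigcup _ _ _ _ _ _ _ _ _ cm) => [m|n].
  have [|xs [szxs xsP]] := greedy_points (S := S) (Gam := Gm m) (Y := Km m) (ltW (th0 m)) g0.
    by move=> y [].
  have [G0|/fset0Pn [u0]] := eqVneq (Gm m) fset0.
    apply: (@cheap_seq _ _ _ _ [::]) => [//|y /xsP [x [u [_ + _ _]]]|].
      by rewrite G0.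
    rewrite big_nil mulr_ge0 ?expR_ge0 // divr_ge0 ?(ltW (th0 m)) //.
    exact: sumr_ge0.
  rewrite !inE => /andP[u0G /eqP u0m].
  (* The word of [U] around [x]: at [h] it takes a member containing the star of [act h x], hence it
     contains every word of [V] through [x] with the same domain. *)
  pose c1 x h := sval (cid2 (starUV (act h x))).
  have c1P x h : U (c1 x h) /\ forall B, V B -> B (act h x) -> B `<=` c1 x h.
    by rewrite /c1; case: cid2.
  have D0 := GD _ u0G; have [j Nj u0j] := D0.
  have DU x : D U N (mkword (F j) (c1 x)).
    by exists j => //; apply: words_mkword => h _; case: (c1P x h).
  have lenU x : word_len (mkword (F j) (c1 x)) = m.
    by rewrite -u0m /word_len u0j.1.
  apply: (@cheap_seq _ _ _ _ [seq mkword (F j) (c1 x) | x <- xs]).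
  - by move=> w /mapP [x _ ->].
  - move=> y [Ky yth]; have [x [u [xxs uG Sux Suy]]] := xsP y (conj Ky yth).
    exists (mkword (F j) (c1 x)); first by apply/mapP; exists x.
    move: uG; rewrite !inE => /andP[uG /eqP um].
    have uj : domf u = F j.
      by rewrite -u0j.1; apply: (domf_word_len F_incr (GD _ uG) D0); rewrite um.
    rewrite word_set_mkword => h hj /=; have hu : h \in domf u by rewrite uj.
    have [i _ [_ Vu]] := GD _ uG.
    apply: (c1P x h).2 _ (Vu [` hu]%fset) _ _ _; first exact: (Sux [` hu]%fset).
    exact: (Suy [` hu]%fset).
  rewrite big_map (eq_bigr (fun=> expR (- (s * m%:R)))); last first.
    by move=> x _; rewrite /weight lenU.
  rewrite big_const_seq count_predT iter_addr_0 -[leLHS]mulr_natl /cm ler_wpM2r ?expR_ge0 //.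
  by rewrite ler_pdivlMr.
(* The [q ^+ m] in the share cancels against the gain from exponent [s'] to [s]; the costs then add
   up to [(B * Q * (1 - q))^-1 * Q], which is [c] by the choice of [B]. *)
have cmE m : cm m = (B * Q * (1 - q))^-1 * \sum_(u <- Gm m) g u * weight s' u.
  rewrite /cm; have -> : \sum_(u <- Gm m) g u * weight s' u =
      (\sum_(u <- Gm m) g u) * expR (- (s' * m%:R)).
    rewrite mulr_suml big_seq [RHS]big_seq; apply: eq_bigr => u.
    by rewrite !inE => /andP[_ /eqP <-].
  have -> : expR (- (s * m%:R)) = q ^+ m * expR (- (s' * m%:R)).
    by rewrite qm -expRD; congr expR; ring.
  have qm0 : q ^+ m != 0 by rewrite expf_neq0 // gt_eqF // expR_gt0.
  rewrite /th; field; rewrite qm0 Qneq0 (gt_eqF B0) /=.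
  by rewrite subr_eq0 eq_sym lt_eqF.
under eq_bigr do rewrite cmE.
rewrite -mulr_sumr.
apply: (@le_trans _ _ ((B * Q * (1 - q))^-1 * Q)).
  rewrite ler_wpM2l ?invr_ge0 ?mulr_ge0 ?(ltW B0) ?subr_ge0 ?(ltW q1) //.
  rewrite /Q (@sum_by_length _ _ (maxn n M)); last first.
    by move=> u /GM uM; rewrite (leq_trans uM) // leq_maxr.
  rewrite -!(big_mkord xpredT (fun m => \sum_(u <- Gm m) g u * weight s' u)).
  rewrite (big_cat_nat (leq0n _) (leq_maxl n M)) /= lerDl sumr_ge0 // => i _.
  by rewrite sumr_ge0 // => u _; rewrite mulr_ge0 ?weight_ge0.
rewrite le_eqVlt; apply/orP; left; apply/eqP.
rewrite /B /frostman_const -/q; field.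
by rewrite Qneq0 (gt_eqF c0) subr_eq0 eq_sym lt_eqF.
Qed.

Lemma frostman_words U V K N s s' c : finite_set V ->
  star_points U V -> 0 < c -> s' < s -> ~ cheap act F K U N s c ->
  exists l : set X -> R, [/\ finadd l, l setT = 1, l (~` K) = 0 &
    forall u, D V N u -> l (S u) <= frostman_const s s' c * weight s' u].
Proof.
move=> finV starUV c0 ss' nK.
have B0 := frostman_const_gt0 c0 ss'.
have [u|n g g0|l [fl l1 lK lr]] := @frostman R X _ S
  (fun u => frostman_const s s' c * weight s' u) K (fun n => short_words F V N n).
- by rewrite mulr_ge0 ?weight_ge0 // ltW.
- apply: cheap_weights nK g0 _ => // u.
  by move=> /(in_short_words F_unbounded _ _ _ finV) [].
exists l; split=> // u Du; apply: lr; exists (word_len u) => // n /= un.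
by apply/(in_short_words F_unbounded _ _ _ finV).
Qed.

End FrostmanWords.

(** * Tight words and the lowering of entropy *)

Lemma compact_finite_subcover (X : topologicalType) (K : set X) (I : choiceType)
    (D : set I) (f : I -> set X) : compact K -> (forall i, D i -> open (f i)) ->
  K `<=` \bigcup_(i in D) f i ->
  exists2 A : {fset I}, [set` A] `<=` D & K `<=` \bigcup_(i in [set` A]) f i.
Proof.
move=> cK fo KD; have [[x0 Kx0]|K0] := pselect (K !=set0); last first.
  by exists fset0 => // x Kx; exfalso; apply: K0; exists x.
pose pX : ptopologicalType := HB.pack X (isPointed.Build X x0).
have : @compact pX K := cK.
rewrite compact_cover => /(_ I D f fo KD) [A AD KA]; exists A => // i iA.
by apply: set_mem; exact: AD.
Qed.

(** Each selected set takes mass [th] shared with no other, and discards all sets that meet it. It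
    discards itself too, being nonempty as a set of positive mass, so the recursion terminates. *)
Lemma greedy_disjoint (R : realType) (X : Type) (T : choiceType)
    (S : T -> set X) (l : set X -> R) (th : R) (A : {fset T}) :
  finadd l -> 0 < th -> (forall u, u \in A -> th <= l (S u)) ->
  exists us : seq T, [/\ (size us)%:R * th <= l (\bigcup_(u in [set` A]) S u),
    {subset us <= A} &
    forall u, u \in A -> exists2 v, v \in us & S u `&` S v !=set0].
Proof.
move=> fl th0; have [n] := ubnP #|` A|.
elim: n A => // n IH A An AS.
have [->|/fset0Pn [v vA]] := eqVneq A fset0.
  by exists [::]; split=> //; rewrite mul0r fl.1.
pose A' := [fset u in A | `[< (S u `&` S v = set0)%classic >]]%fset.
have A'A : {subset A' <= A} by move=> u; rewrite !inE => /andP[].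
have Sv0 : S v !=set0.
  apply/set0P/negP => /eqP S0; have := AS v vA.
  by rewrite S0 finadd_set0 // leNgt th0.
have A'n : (#|` A'| < n)%N.
  move: An; rewrite (cardfsD1 v A) vA add1n ltnS; apply: leq_ltn_trans.
  apply: fsubset_leq_card; apply/fsubsetP => u; rewrite !inE => /andP[-> /asboolP E].
  rewrite andbT; apply: contraPN Sv0 => /eqP uv.
  by move: E; rewrite uv setIid => ->; case.
have [|us [szus usA usP]] := IH A' A'n; first by move=> u /A'A; exact: AS.
exists (v :: us); split.
- rewrite /= -[_.+1%:R]natr1 mulrDl mul1r (le_trans (lerD szus (AS v vA))) //.
  rewrite -fl.2; last first.
    apply/seteqP; split=> // x [[u /= + Su] Sv]; rewrite !inE => /andP[_ /asboolP E].
    by have : (S u `&` S v) x by []; rewrite E.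
  by apply: le_finadd => // x [[u /A'A uA Su]|Sv]; [exists u|exists v].
- by move=> u; rewrite inE => /orP[/eqP ->//|/usA/A'A].
move=> u uA; have [E|/eqP/set0P ne] := pselect (S u `&` S v = set0); last first.
  by exists v => //; rewrite inE eqxx.
have [|w wus uw] := usP u; first by rewrite !inE uA; apply/asboolP.
by exists w => //; rewrite inE wus orbT.
Qed.

Section Lowering.
Variables (R : realType) (G : groupType) (X : topologicalType).
Variables (act : G -> X -> X) (F : nat -> {fset G}).
Hypothesis F_incr : forall n, (F n `<=` F n.+1)%fset.
Hypothesis F_unbounded : forall m, exists N, forall n, (N <= n)%N -> (m <= #|` F n|)%N.
Hypothesis act_cont : forall g, continuous (act g).
Local Notation word := {fmap G -> set X}.
Local Notation D := (@deep_words G X F).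
Local Notation S := (word_set act).
Implicit Types (K : set X) (u : word).
Variables (U V : set (set X)) (N : nat) (s B : R).
Hypothesis covV : finite_open_cover V.
Hypothesis starUV : forall A, V A -> exists2 A', U A' &
  forall B, V B -> A `&` B !=set0 -> closure B `<=` A'.
Hypotheses (s0 : 0 < s) (B0 : 0 < B).
Let r u := B * weight s u.
Let finV : finite_set V. Proof. by case: covV. Qed.

(** Closures are taken letter by letter; the result is closed, may exceed the closure of
    [word_set act u], and is still swallowed by the enlarged words of [U]. *)
Definition closed_word u : set X :=
  \bigcap_(g in [set: domf u]) (act (val g) @^-1` closure (u g)).

Lemma closed_closed_word u : closed (closed_word u).
Proof.
apply: closed_bigI => g _; apply: closed_comp => [x _|]; first exact: act_cont.
exact: closed_closure.
Qed.

Lemma sub_closed_word u : S u `<=` closed_word u.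
Proof. by move=> x Sx g _; apply: subset_closure; exact: Sx. Qed.

(** Disjoint tight words of length [m] have mass at least [B * expR (- (s m)) / 2] each, so there
    are at most [2 / B * expR (s m)]. Enlarged to stars, they cover all tight words of that length
    at cost [2 / B * expR (- (t - s) m)], and the sum over [m >= k] is geometric. *)
Lemma tight_cheap (l : set X -> R) (T : {fset word}) (t : R) (N' k : nat) :
  finadd l -> l setT <= 1 -> s < t ->
  (forall u, D U 0 u -> (k <= word_len u)%N -> D U N' u) ->
  (forall u, u \in T -> D V N u /\ (k <= word_len u)%N) ->
  (forall u, u \in T -> r u / 2 <= l (S u)) ->
  cheap act F (\bigcup_(u in [set` T]) closed_word u) U N' t
    (2 / B / (1 - expR (- (t - s))) * expR (- ((t - s) * k%:R))).
Proof.
move=> fl l1 st kN' TD Tl.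
pose q := expR (- (t - s)); have q0 : 0 <= q by exact: expR_ge0.
have q1 : q < 1 by rewrite -[ltRHS]expR0 ltr_expR oppr_lt0 subr_gt0.
have qm m : q ^+ m = expR (- ((t - s) * m%:R)) by rewrite -expRM_natl mulrN mulrC.
pose Tm m := [fset u in T | word_len u == m]%fset.
pose cm m : R := if (k <= m)%N then 2 / B * q ^+ m else 0.
apply: (@cheapW _ _ _ _ _ (\bigcup_m \bigcup_(u in [set` Tm m]) closed_word u)
   _ U N' N' t t _ _ _ _ _ _ _) => //.
  move=> x [u uT xu]; exists (word_len u) => //; exists u => //=.
  by rewrite !inE eqxx andbT.
apply: (@cheap_bigcup _ _ _ _ _ _ _ _ _ cm) => [m|n]; last first.
  rewrite -qm -(big_mkord xpredT cm).
  apply: (@le_trans _ _ (\sum_(0 <= m < k + n) cm m)).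
    rewrite (big_cat_nat (leq0n _) (leq_addl k n)) /= lerDl sumr_ge0 // => m _.
    rewrite /cm; case: ifP => // _.
    by rewrite mulr_ge0 ?exprn_ge0 // divr_ge0 // ltW.
  rewrite (big_cat_nat (leq0n _) (leq_addr n k)) /= big_nat big1 ?add0r; last first.
    by move=> m /andP[_ mk]; rewrite /cm leqNgt mk.
  rewrite -{1}[k]add0n big_addn addKn big_mkord.
  rewrite (eq_bigr (fun m : 'I_n => 2 / B * q ^+ k * q ^+ m)); last first.
    by move=> m _; rewrite /cm leq_addl exprD; ring.
  rewrite -mulr_sumr.
  have q1' : 0 < 1 - q by rewrite subr_gt0.
  have := geometric_sum_le n q0 q1; rewrite mulrC -ler_pdivlMr // div1r => qs.
  rewrite [leRHS]mulrAC ler_wpM2l // mulr_ge0 ?exprn_ge0 //.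
  by rewrite divr_ge0 // ltW.
rewrite /cm; case: leqP => [km|mk]; last first.
  apply: (@cheap_seq _ _ _ _ _ _ _ _ _ [::]) => //; last by rewrite big_nil.
  move=> x [u /=]; rewrite !inE => /andP[uT /eqP um].
  by have := (TD u uT).2; rewrite um leqNgt mk.
pose th := B * expR (- (s * m%:R)) / 2.
have th0 : 0 < th by rewrite divr_gt0 // mulr_gt0 // expR_gt0.
have [u|us [szus usT usP]] := greedy_disjoint (S := S) (A := Tm m) fl th0.
  by rewrite !inE => /andP[uT /eqP um]; rewrite /th -um; exact: Tl.
have szth : (size us)%:R <= 2 / B * expR (s * m%:R).
  have := le_trans szus (le_trans (le_finadd fl (@subsetT _ _)) l1).
  rewrite -ler_pdivlMr // => /le_trans -> //.
  rewrite /th expRN div1r invfM invrK invfM invrK.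
  by rewrite le_eqVlt; apply/orP; left; apply/eqP; ring.
have starV A : exists A', V A -> U A' /\
    forall B, V B -> A `&` B !=set0 -> closure B `<=` A'.
  have [VA|nVA] := pselect (V A); last by exists A.
  by have [A' UA' H] := starUV VA; exists A'.
pose st' A := sval (cid (starV A)); have st'P A := svalP (cid (starV A)).
pose cw u : word := [fmap g : domf u => st' (u g)].
have usD u : u \in us -> D V N u /\ word_len u = m.
  move=> /usT; rewrite !inE => /andP[uT /eqP um]; split=> //; exact: (TD u uT).1.
apply: (@cheap_seq _ _ _ _ _ _ _ _ _ (map cw us)).
- move=> _ /mapP [u uus ->]; have [Du um] := usD u uus; apply: kN'; last by move: km; rewrite -um.
  have [j Nj [uj Vu]] := Du; exists j => //; split=> // g.
  by rewrite ffunE; apply: (st'P _ _).1; exact: Vu.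
- move=> x [u uTm xu]; have [v vus [y [uy vy]]] := usP u uTm.
  exists (cw v) => /=; first by apply/mapP; exists v.
  have [Dv vm] := usD v vus.
  move: uTm; rewrite /= !inE => /andP[uT /eqP um].
  have [Du _] := TD u uT.
  have duv : domf u = domf v by apply: (domf_word_len F_incr Du Dv); rewrite um.
  move=> g _ /=; rewrite ffunE.
  have gu : val g \in domf u by rewrite duv; exact: valP.
  have [i _ [_ Vu]] := Du; have [j _ [_ Vv]] := Dv.
  apply: (st'P _ (Vv g)).2 (Vu [` gu]%fset) _ _ _; last exact: (xu [` gu]%fset).
  exists (act (val g) y); split; first exact: (vy g).
  exact: (uy [` gu]%fset).
rewrite big_map big_seq (eq_bigr (fun=> expR (- (t * m%:R)))); last first.
  by move=> u /usD [_ um]; rewrite /weight -um.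
rewrite -big_seq big_const_seq count_predT iter_addr_0 -[leLHS]mulr_natl.
have -> : q ^+ m = expR (s * m%:R) * expR (- (t * m%:R)).
  by rewrite qm -expRD; congr expR; ring.
by rewrite mulrA ler_wpM2r ?expR_ge0.
Qed.

(** The exceptional set [Sh] consists of the words of length at most [k]. The partition is obtained
    by making the words over a single [F j] disjoint; since [s > 0], a large [j] makes the mass of a
    cell small compared with [eps / (#|Sh| + 1)]. *)
Lemma tight_words K (l0 : set X -> R) (eps : R) (k : nat) :
  feasible S r (D V N) K l0 -> 0 < eps ->
  exists l p, [/\ feasible S r (D V N) K l, l setT = l0 setT &
    l (~` tight S r [set u | D V N u /\ (k <= word_len u < p)%N] l) <= eps].
Proof.
move=> l0F eps0; pose Sh := short_words F V N k.
have [m Bm] := expRN_small (B * (#|` Sh|.+1)%:R) s0 (divr_gt0 eps0 (ltr0n R 4)).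
have [N' N'm] := F_unbounded m.
pose j := maxn N N'; have mj : (m <= #|` F j|)%N by apply: N'm; exact: leq_maxr.
pose W := fset_set (words V (F j)); pose w (i : 'I_(size W)) := tnth (in_tuple W) i.
have wV i : words V (F j) (w i).
  by apply/set_mem; rewrite -in_fset_set; [exact: mem_tnth|exact: finite_words].
pose P i := S (w i) `\` \bigcup_(i' in [set i' : 'I_(size W) | (i' < i)%N]) S (w i').
pose b := B * expR (- (s * #|` F j|%:R)).
apply: (@tight_concentration R X _ S r (D V N) K l0 'I_(size W) P b eps Sh
  (fun p => [set u | D V N u /\ (k <= word_len u < p)%N])) => //.
- move=> i i' x [Si nSi] [Si' nSi']; apply/val_inj/eqP.
  case: ltngtP => // ii'.
    by exfalso; apply: nSi'; exists i.
  by exfalso; apply: nSi; exists i'.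
- apply/seteqP; split=> // x _.
  have [u uW Sx] := @word_cover _ _ act V (F j) covV x I.
  have [i Si] : exists i, S (w i) x.
    have uW' : u \in W by rewrite in_fset_set ?mem_set //; exact: finite_words.
    have [i E] := tnthP (in_tuple W) _ uW'.
    by exists i; rewrite /w -E.
  have /asboolP Si' := Si.
  case: (@arg_minnP _ i (fun i => `[< S (w i) x >]) (fun i => val i) Si') => i0 /asboolP Si0 mini.
  rewrite -bigcup_seq; exists i0; first by rewrite /= mem_index_enum.
  split=> // -[i' /= ii0 Si'x]; have := mini i'; rewrite leqNgt ii0.
  by move=> /(_ (asboolT Si'x)).
- move=> l [fl _ lr] i; apply: (@le_trans _ _ (l (S (w i)))).
    by apply: le_finadd => // x [].
  apply: (le_trans (lr _ _)); first by exists j => //=; exact: leq_maxl.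
  by rewrite /r /weight /word_len (wV i).1.
- by rewrite mulr_ge0 ?expR_ge0 // ltW.
- apply: (@le_lt_trans _ _ (eps / 4)); last by rewrite ltr_pM2l // ltf_pV2 ?posrE // ltr_nat.
  apply: le_trans Bm; rewrite /b mulrAC ler_wpM2l ?mulr_ge0 ?(ltW B0) //.
  by rewrite ler_expR lerN2 ler_wpM2l ?ler_nat // ltW.
- move=> p q pq u [Du /andP[ku up]]; split=> //; rewrite ku /=; exact: leq_trans up pq.
move=> u Du; have [uk|ku] := leqP (word_len u) k.
  by left; apply/(in_short_words F_unbounded _ _ _ finV).
by right; exists (word_len u).+1 => //; split=> //; rewrite ltnW /=.
Qed.

Definition tightly_covered k (C : set X) : Prop :=
  exists (l : set X -> R) (T : {fset word}), [/\ finadd l, l setT <= 1,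
    forall u, u \in T -> [/\ D V N u, (k <= word_len u)%N & r u / 2 <= l (S u)] &
    C `<=` \bigcup_(u in [set` T]) closed_word u].

(** Restricting [l'] to its tight part keeps it feasible, since values only decrease, and costs at
    most [eps]. The bound [p] on lengths leaves finitely many tight words, so the new set is
    closed. *)
Lemma tightly_covered_step K (k : nat) (C : set X) (l : set X -> R) (eps : R) :
  closed C -> feasible S r (D V N) (K `&` C) l -> l setT <= 1 -> 0 < eps ->
  exists (C' : set X) (l' : set X -> R), [/\ closed C', C' `<=` C,
    tightly_covered k C', feasible S r (D V N) (K `&` C') l' &
    l' setT <= 1 /\ l setT - eps <= l' setT].
Proof.
move=> cC lF l1 eps0; have [l' [p [l'F l'T l'eps]]] := tight_words k lF eps0.
have [fl l'K l'r] := l'F.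
set Q := [set u | _ /\ _] in l'eps.
have finQ : finite_set [set u | Q u /\ r u / 2 <= l' (S u)].
  apply: sub_finite_set (finite_short_words F_unbounded p finV) => u.
  move=> [[Du /andP[_ /ltnW up]] _]; split=> //; exact: deep_wordsS Du.
pose T := fset_set [set u | Q u /\ r u / 2 <= l' (S u)].
have TP u : u \in T -> Q u /\ r u / 2 <= l' (S u).
  by rewrite in_fset_set // => /set_mem.
pose C' := C `&` \bigcup_(u in [set` T]) closed_word u.
exists C', (fun A => l' (A `&` tight S r Q l')); split.
- apply: closedI => //; apply: closed_bigcup => [|u _]; first exact: finite_fset.
  exact: closed_closed_word.
- by move=> x [].
- exists l', T; split=> //; first by rewrite l'T.
    by move=> u /TP [[Du /andP[ku _]] ru].
  by move=> x [].
- split; first exact: finadd_setI.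
    apply/eqP; rewrite eq_le fl.1 andbT -l'K; apply: le_finadd => // x [nx [u uT Su]].
    move=> [Kx Cx]; apply: nx; split=> //; split=> //.
    exists u; last exact: sub_closed_word.
    by rewrite /= in_fset_set // mem_set.
  move=> u Du; apply: le_trans (l'r u Du); by apply: le_finadd => // x [].
split; first by rewrite setTI; apply: le_trans l1; rewrite -l'T; apply: le_finadd.
rewrite setTI lerBlDr -l'T (finadd_setID fl setT (tight S r Q l')) setTI setTD.
by rewrite lerD2l.
Qed.

(** The losses [2^-1 / 2 ^+ k.+1] leave mass above 1/2 at every stage, whereas a cover by words of
    [V] of cost [B^-1 / 4] would carry at most 1/4. *)
Lemma lowering K (l0 : set X -> R) t : compact K ->
  feasible S r (D V N) K l0 -> l0 setT = 1 -> s < t ->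
  exists L, [/\ L `<=` K, null act F L U t &
    ~ cheap act F L V N s (B^-1 / 4)].
Proof.
move=> cK l0F l0T st.
pose inv k (p : set X * (set X -> R)) := [/\ closed p.1,
  feasible S r (D V N) (K `&` p.1) p.2, p.2 setT <= 1 &
  2^-1 + 2^-1 / 2 ^+ k <= p.2 setT].
pose rel k (p p' : set X * (set X -> R)) := p'.1 `<=` p.1 /\ tightly_covered k p'.1.
have [||f fP] := @dependent_chain _ inv rel (setT, l0).
- split; rewrite /= ?setIT ?l0T ?expr0 //; lra.
- move=> k [C l] [/= cC lF l1 lk].
  have eps0 : 0 < 2^-1 / 2 ^+ k.+1 :> R by rewrite divr_gt0 // exprn_gt0.
  have [C' [l' [cC' CC' tC' l'F [l'1 ll']]]] := tightly_covered_step k cC lF l1 eps0.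
  exists (C', l'); do 2 split=> //=; apply: le_trans ll'.
  rewrite lerBrDr -addrA; apply: le_trans lk; rewrite lerD2l.
  by rewrite le_eqVlt; apply/orP; left; apply/eqP; rewrite exprS; field; rewrite expf_neq0.
pose C k := (f k).1; pose l k := (f k).2.
have Cmono i j : (i <= j)%N -> C j `<=` C i.
  elim: j => [|j IH]; first by rewrite leqn0 => /eqP ->.
  rewrite leq_eqVlt => /orP[/eqP -> //|/IH ji]; apply: subset_trans ji.
  exact: (fP j).2.1.
exists (K `&` \bigcap_k C k); split; first by move=> x [].
- move=> N' e e0; have [M NM] := @long_words_deep G X F F_incr N'.
  have ts0 : 0 < t - s by rewrite subr_gt0.
  have [k ke] := expRN_small (2 / B / (1 - expR (- (t - s)))) ts0 e0.
  have [l' [T [fl' l'1 TP CT]]] := (fP (maxn k M)).2.2.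
  have := @tight_cheap l' T t N' (maxn k M) fl' l'1 st _ _ _.
  have H1 u : D U 0 u -> (maxn k M <= word_len u)%N -> D U N' u.
    by move=> Du; rewrite geq_max => /andP[_]; exact: NM.
  move=> /(_ H1) {H1}.
  have H2 u : u \in T -> D V N u /\ (maxn k M <= word_len u)%N by move/TP => [].
  have H3 u : u \in T -> r u / 2 <= l' (S u) by move/TP => [].
  move=> /(_ H2 H3); apply: cheapW => //.
    by move=> x [_ Cx]; apply: CT; exact: Cx.
  apply: le_trans ke; rewrite ler_wpM2l //.
    rewrite divr_ge0 //; first by rewrite divr_ge0 // ltW.
    by rewrite subr_ge0 -[leRHS]expR0 ler_expR oppr_le0 ltW.
  by rewrite ler_expR lerN2 ler_wpM2l ?ler_nat ?leq_maxl // ltW.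
move=> [L [LD KL Lc]].
(* The mass sits on the sets [K] and [C k] intersected, not on the limit set. With the complements
   of the [C k] added to the open family, compactness shows that finitely many words already cover
   one such intersection. *)
pose fam (x : nat + word) := match x with inl k => ~` C k | inr u => S u end.
pose Dx : set (nat + word) := [set x | if x is inr u then L u else True].
have [[k _|u Lu]|x Kx|A AD KA] := @compact_finite_subcover _ _ _ Dx fam cK.
- by rewrite /= openC; case: (fP k) => -[].
- have [i _ ui] := LD u Lu; case: covV => _ oV _.
  exact: word_set_open ui.
- have [Cx|/existsNP [k nk]] := pselect (forall k, C k x).
    by have [|u Lu Sx] := KL x; [split=> // k _|exists (inr u)].
  by exists (inl k).
pose k := (\max_(x <- A) (if x is inl k then k else 0))%N.
pose A' := [fset u | u in pmap (fun x : nat + word => if x is inr u then Some u else None) A]%fset.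
have A'P u : u \in A' <-> inr u \in A.
  rewrite !inE mem_pmap; split=> [/mapP [[//|v] vA [->]] //|uA].
  by apply/mapP; exists (inr u).
have KC : K `&` C k `<=` \bigcup_(u in [set` A']) S u.
  move=> x [Kx Ckx]; have [[i|u] iA] := KA x Kx; last first.
    by exists u => //=; apply/A'P.
  move=> /= nC; exfalso; apply: nC; apply: Cmono Ckx.
  by rewrite /k (big_rem (inl i) iA) leq_maxl.
have [[cCk [fl lK lr] l1 lk] _] := fP k.
have lA' : l k setT <= \sum_(u <- A') r u.
  rewrite /l (finadd_setID fl _ (K `&` C k)) setTI setTD lK addr0.
  apply: (le_trans (le_finadd fl KC)); apply: (le_trans (finadd_bigcup_le fl S A')).
  rewrite big_seq [leRHS]big_seq; apply: ler_sum => u /A'P uA; apply: lr.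
  exact: LD (AD _ uA).
have : l k setT <= 4^-1.
  apply: (le_trans lA'); rewrite -mulr_sumr mulrC -ler_pdivlMr // mulrC.
  by apply: Lc => u /A'P uA; exact: (AD _ uA).
have : 0 < 2^-1 / 2 ^+ k :> R by rewrite divr_gt0 // exprn_gt0.
move: lk; rewrite -/(l k); lra.
Qed.

End Lowering.

(** * The Ornstein-Weiss lemma *)

Section Tiling.
Variables (R : realType) (G : groupType).
Implicit Types (A D E S : {fset G}) (c g : G).

Definition rtrans A c : {fset G} := [fset (a * c)%g | a in A]%fset.

(** The [g] outside [A] for which the translate of [S] by [g] meets [A]; the form [s^-1 * a]
    exhibits them inside a finite set. *)
Definition outer_bdr S A : {fset G} :=
  [fset g in [fset (s^-1 * a)%g | s in S, a in A] | g \notin A]%fset.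

Definition inner_bdr S A : {fset G} :=
  [fset g in A | ~~ (rtrans S g `<=` A)%fset]%fset.

Lemma outer_bdrP S A g : g \in outer_bdr S A ->
  exists2 s, s \in S & (s * g)%g \in A /\ g \notin A.
Proof.
rewrite !inE => /andP[/imfset2P [s /= sS [a /= aA ->]] nA].
by exists s => //; rewrite mulVKg.
Qed.

Lemma inner_bdrP S A g : g \in inner_bdr S A ->
  exists2 s, s \in S & g \in A /\ (s * g)%g \notin A.
Proof.
rewrite !inE => /andP[gA /fsubsetPn [_ /imfsetP [s /= sS ->] sgA]].
by exists s.
Qed.

Lemma in_symdiff_ltrans A s g : (g \in A) != ((s * g)%g \in A) ->
  g \in symdiff A (ltrans s^-1%g A).
Proof.
have -> : ((s * g)%g \in A) = (g \in ltrans s^-1%g A).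
  apply/idP/imfsetP => [sg|[a aA ->]]; last by rewrite mulVKg.
  by exists (s * g)%g => //; rewrite mulKg.
by rewrite in_fsetU !in_fsetD; case: (g \in A); case: (g \in ltrans _ _).
Qed.

Lemma inner_bdr_sub S A : (inner_bdr S A `<=` A)%fset.
Proof. by apply/fsubsetP => g; rewrite !inE => /andP[]. Qed.

Lemma card_rtrans A c : #|` rtrans A c| = #|` A|.
Proof. by rewrite card_imfset //=; exact: mulIg. Qed.

Lemma outer_bdr_rtrans S A c :
  (#|` outer_bdr S (rtrans A c)| <= #|` outer_bdr S A|)%N.
Proof.
rewrite -(card_rtrans (outer_bdr S A) c); apply: fsubset_leq_card.
apply/fsubsetP => g; rewrite !inE => /andP[].
case/imfset2P => s /= sS [_ /imfsetP [a /= aA ->] ->] gA.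
apply/imfsetP; exists (s^-1 * a)%g; last by rewrite mulgA.
rewrite !inE; apply/andP; split; first by apply/imfset2P; exists s => //; exists a.
by apply: contra gA => sa; apply/imfsetP; exists (s^-1 * a)%g => //=; rewrite mulgA.
Qed.

Lemma outer_bdrU S A D :
  (#|` outer_bdr S (A `|` D)%fset| <= #|` outer_bdr S A| + #|` outer_bdr S D|)%N.
Proof.
apply: leq_trans (leq_card_fsetU _ _); apply: fsubset_leq_card.
apply/fsubsetP => g; rewrite !inE negb_or => /andP[/imfset2P [s /= sS [a aAD ->]]].
move=> /andP[-> ->]; rewrite !andbT; move: aAD; rewrite /= inE => /orP[aA|aD].
  by apply/orP; left; apply/imfset2P; exists s => //; exists a.
by apply/orP; right; apply/imfset2P; exists s => //; exists a.
Qed.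

Lemma inner_bdrD S A D : (D `<=` A)%fset ->
  (#|` inner_bdr S (A `\` D)%fset| <= #|` inner_bdr S A| + #|` outer_bdr S D|)%N.
Proof.
move=> DA; apply: leq_trans (leq_card_fsetU _ _); apply: fsubset_leq_card.
apply/fsubsetP => g; rewrite !inE => /andP[/andP[gD gA] /fsubsetPn [_ /imfsetP[s /= sS ->]]].
rewrite !inE negb_and negbK => /orP[sgD|sgA]; apply/orP; [right|left]; last first.
  rewrite gA /=; apply/fsubsetPn; exists (s * g)%g => //.
  by apply/imfsetP; exists s.
rewrite gD andbT; apply/imfset2P; exists s => //; exists (s * g)%g => //.
by rewrite mulKg.
Qed.

(** Double counting of the pairs with [e * c] in [D]: each [e] admits at most [#|D|] values of
    [c]. *)
Lemma sum_card_rtransI E D A :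
  (\sum_(c <- A) #|` (rtrans E c `&` D)%fset| <= #|` E| * #|` D|)%N.
Proof.
have cardE c : #|` (rtrans E c `&` D)%fset| = (\sum_(e <- E) (e * c \in D)%g)%N.
  have -> : (rtrans E c `&` D)%fset = rtrans [fset e in E | (e * c)%g \in D]%fset c.
    apply/fsetP => g; rewrite !inE; apply/andP/imfsetP.
      by case=> /imfsetP [e /= eE ->] gD; exists e => //; rewrite !inE eE.
    case=> e /=; rewrite !inE => /andP[eE eD] ->; split=> //.
    by apply/imfsetP; exists e.
  by rewrite card_rtrans card_fset_sum1 -big_fset_condE big_mkcond; apply: eq_bigr => e _;
    case: (_ \in D).
under eq_bigr do rewrite cardE.
rewrite exchange_big /= card_fset_sum1 big_distrl /=; apply: leq_sum => e _.
rewrite mul1n.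
rewrite (_ : \sum_(c <- A) _ = #|` [fset c in A | (e * c)%g \in D]%fset|)%N; last first.
  by rewrite card_fset_sum1 -big_fset_condE [RHS]big_mkcond; apply: eq_bigr => c _;
    case: (_ \in D).
set B := [fset c in A | _]%fset.
apply: (@leq_trans #|` [fset (e * c)%g | c in B]%fset|).
  by rewrite [leqRHS]card_imfset //=; exact: mulgI.
apply: fsubset_leq_card; apply/fsubsetP => _ /imfsetP [c + ->].
by rewrite !inE => /andP[].
Qed.

Section Subadditive.
Variable phi : {fset G} -> R.
Hypothesis phi0 : phi fset0 = 0.
Hypothesis phiU : forall A B, phi (A `|` B)%fset <= phi A + phi B.
Hypothesis phi_rtrans : forall A c, phi (rtrans A c) <= phi A.

(* A maximal union of translates, each new one having at most a proportion [eta]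
   already covered, meets every translate contained in A in that proportion. *)
Lemma tile_step E A (eta : R) : E != fset0 -> 0 < eta -> eta < 1 ->
  exists D n, [/\ (D `<=` A)%fset,
    n%:R * #|` E|%:R * (1 - eta) <= #|` D|%:R,
    phi D <= n%:R * phi E,
    forall S, (#|` outer_bdr S D| <= n * #|` outer_bdr S E|)%N &
    eta * #|` (A `\` inner_bdr E A)%fset|%:R <= #|` D|%:R].
Proof.
move=> E0 eta0 eta1.
pose ok D n := [/\ (D `<=` A)%fset,
    n%:R * #|` E|%:R * (1 - eta) <= #|` D|%:R,
    phi D <= n%:R * phi E &
    forall S, (#|` outer_bdr S D| <= n * #|` outer_bdr S E|)%N].
have ex : exists k, `[< exists D n, ok D n /\ #|` D| = k >].
  exists 0%N; apply/asboolP; exists fset0, 0%N; split; last by rewrite cardfs0.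
  split; rewrite ?fsub0set ?mul0r ?cardfs0 ?phi0 // => S.
  rewrite mul0n leqn0 cardfs_eq0; apply/eqP/fsetP => g; rewrite !inE andbT.
  by apply/imfset2P => -[s _ [a]]; rewrite inE.
have ub k : `[< exists D n, ok D n /\ #|` D| = k >] -> (k <= #|` A|)%N.
  by move=> /asboolP [D [n [[DA _ _ _] <-]]]; exact: fsubset_leq_card.
case: (ex_maxnP ex ub) => k /asboolP [D [n [Dok Dk]]] kmax.
have [DA nD phiD bD] := Dok.
exists D, n; split=> //.
have cE0 : 0 < #|` E|%:R :> R by rewrite ltr0n cardfs_gt0.
have H c : c \in (A `\` inner_bdr E A)%fset ->
    eta * #|` E|%:R <= #|` (rtrans E c `&` D)%fset|%:R.
  rewrite !inE => /andP[+ cA]; rewrite cA /= negbK => EcA.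
  rewrite leNgt; apply/negP => lt.
  have cU : #|` (D `|` rtrans E c)%fset|%:R =
      #|` D|%:R + (#|` E|%:R - #|` (rtrans E c `&` D)%fset|%:R) :> R.
    rewrite -(card_rtrans E c) addrA -natrD -cardfsUI natrD fsetIC addrK //.
  have /kmax : `[< exists D' n', ok D' n' /\ #|` D'| = #|` (D `|` rtrans E c)%fset| >].
    apply/asboolP; exists (D `|` rtrans E c)%fset, n.+1; split=> //; split.
    - by rewrite fsubUset DA EcA.
    - rewrite cU -natr1 mulrDl mulrDl lerD // mul1r; lra.
    - apply: (le_trans (phiU _ _)); rewrite -natr1 mulrDl mul1r lerD //.
    - move=> S; apply: leq_trans (outer_bdrU _ _ _) _.
      by rewrite mulSn addnC leq_add // outer_bdr_rtrans.
  rewrite -Dk -(ler_nat R) cU; nra.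
have : #|` (A `\` inner_bdr E A)%fset|%:R * (eta * #|` E|%:R) <= #|` E|%:R * #|` D|%:R :> R.
  rewrite -natrM; apply: le_trans (_ : _ <= (\sum_(c <- (A `\` inner_bdr E A)%fset)
     #|` (rtrans E c `&` D)%fset|)%:R) _; last by rewrite ler_nat sum_card_rtransI.
  rewrite natr_sum card_fset_sum1 natr_sum mulr_suml big_seq [leRHS]big_seq.
  by apply: ler_sum => c cA; rewrite mul1r H.
by rewrite mulrA mulrC ler_pM2l // mulrC.
Qed.

(** The tiles are used in the order of the list, each on what the previous ones left. Pairwise
    near-invariance keeps the remainder nearly invariant for the later tiles, and each one removes a
    proportion [eta / 2] of it until less than [eta] of [A] is left. *)
Lemma quasi_tiling (lam eta dl : R) (A : {fset G}) (Es : seq {fset G}) (D : {fset G}) (b : R) :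
  0 <= lam -> 0 < eta -> eta <= 2^-1 -> 0 <= dl ->
  (forall E, E \in Es -> [/\ E != fset0, phi E <= lam * #|` E|%:R &
    #|` inner_bdr E (A `\` D)%fset|%:R <= b * #|` A|%:R]) ->
  pairwise (fun E S => #|` outer_bdr S E|%:R <= dl * #|` E|%:R) Es ->
  b + 2 * dl * (size Es)%:R <= eta / 2 ->
  (D `<=` A)%fset -> phi D <= lam / (1 - eta) * #|` D|%:R ->
  exists D', [/\ (D' `<=` A)%fset, phi D' <= lam / (1 - eta) * #|` D'|%:R &
    #|` (A `\` D')%fset|%:R <=
      Num.max (eta * #|` A|%:R) ((1 - eta / 2) ^+ (size Es) * #|` (A `\` D)%fset|%:R)].
Proof.
move=> lam0 eta0 eta12 dl0.
elim: Es D b => [|E Es IH] D b HEs.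
  by exists D; split=> //; rewrite expr0 mul1r le_max lexx orbT.
rewrite pairwise_cons => /andP[/allP EEs pEs] bd DA phiD.
have [small|large] := lerP (#|` (A `\` D)%fset|%:R) (eta * #|` A|%:R).
  by exists D; split=> //; rewrite le_max small.
have [E0 phiE bE] := HEs E (mem_head _ _).
have eta1 : eta < 1 by rewrite (le_lt_trans eta12) // invf_lt1 // ltr1n.
have [D1 [n [D1A nD1 phiD1 bD1 I1]]] := tile_step (A `\` D)%fset E0 eta0 eta1.
have cE0 : 0 < #|` E|%:R :> R by rewrite ltr0n cardfs_gt0.
have n_ge0 : 0 <= n%:R :> R by [].
have D1D : [disjoint D & D1]%fset.
  apply/fdisjointP => g gD; apply/negP => /(fsubsetP D1A); rewrite inE gD.
  by [].
have cU : #|` (D `|` D1)%fset|%:R = #|` D|%:R + #|` D1|%:R :> R.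
  by rewrite cardfsU (eqP D1D) cardfs0 subn0 natrD.
have D1A' : (D1 `<=` A)%fset by apply: fsubset_trans D1A (fsubsetDl _ _).
have eta1' : 0 < 1 - eta by rewrite subr_gt0.
have cD1A : #|` D1|%:R <= #|` A|%:R :> R by rewrite ler_nat fsubset_leq_card.
(* The [n] translates satisfy [n #|E| (1 - eta) <= #|D1| <= #|A|] with [eta <= 1/2], so their outer
   boundaries total at most [2 * dl * #|A|]: the increase of [b]. *)
have [|||||D' [D'A phiD' cD']] := IH (D `|` D1)%fset (b + 2 * dl).
- move=> S SEs; have [S0 phiS bS] := HEs S (mem_behead (s := E :: Es) SEs); split=> //.
  rewrite -fsetDDl; apply: (@le_trans _ _
      (#|` inner_bdr S (A `\` D)%fset|%:R + #|` outer_bdr S D1|%:R)).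
    by rewrite -natrD ler_nat inner_bdrD.
  rewrite mulrDl lerD //.
  apply: (@le_trans _ _ (n%:R * #|` outer_bdr S E|%:R)); first by rewrite -natrM ler_nat.
  apply: (le_trans (ler_wpM2l n_ge0 (EEs S SEs))).
  rewrite mulrCA [2 * dl]mulrC -[leRHS]mulrA ler_wpM2l //.
  have : 0 <= n%:R * #|` E|%:R :> R by rewrite mulr_ge0.
  nra.
- by [].
- by move: bd; rewrite /= -natr1; lra.
- by rewrite fsubUset DA.
- rewrite cU mulrDr; apply: (le_trans (phiU _ _)); apply: lerD => //.
  apply: (le_trans phiD1); rewrite mulrAC ler_pdivlMr //.
  have := ler_wpM2l lam0 nD1; have := ler_wpM2l n_ge0 phiE.
  move=> h1 h2; have := ler_wpM2r (ltW eta1') h1; lra.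
exists D'; split=> //; apply: (le_trans cD'); rewrite ge_max le_max lexx /=.
rewrite le_max; apply/orP; right; rewrite /= exprSr -mulrA ler_wpM2l ?exprn_ge0 //.
  by lra.
(* As the remainder exceeds [eta * #|A|], its inner boundary is at most half of it. *)
have b_le : b <= eta / 2.
  by apply: le_trans bd; rewrite lerDl mulr_ge0 // mulr_ge0.
have bA : b * #|` A|%:R <= eta / 2 * #|` A|%:R by rewrite ler_wpM2r.
have iE : #|` (A `\` D `\` inner_bdr E (A `\` D))%fset|%:R =
    #|` (A `\` D)%fset|%:R - #|` inner_bdr E (A `\` D)%fset|%:R :> R.
  by rewrite cardfsDS ?natrB ?fsubset_leq_card // inner_bdr_sub.
rewrite -fsetDDl cardfsDS // natrB ?fsubset_leq_card //.
move: I1; rewrite iE; nra.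
Qed.

End Subadditive.
End Tiling.

Section OrnsteinWeiss.
Variables (R : realType) (G : groupType) (F : nat -> {fset G}).
Hypothesis F_folner : folner R F.

Lemma card_fset_le_sum (A S : {fset G}) (C : G -> {fset G}) :
  (forall g, g \in A -> exists2 s, s \in S & g \in C s) ->
  (#|` A| <= \sum_(s <- S) #|` C s|)%N.
Proof.
move=> AC; apply: (@leq_trans (\sum_(s <- S) \sum_(g <- A) (g \in C s))%N).
  rewrite exchange_big /= card_fset_sum1 big_seq [leqRHS]big_seq; apply: leq_sum => g gA.
  have [s sS gC] := AC g gA.
  by rewrite (big_rem s sS) /= gC.
apply: leq_sum => s _.
rewrite (_ : \sum_(g <- A) _ = #|` [fset g in A | g \in C s]%fset|)%N; last first.
  by rewrite card_fset_sum1 -big_fset_condE [RHS]big_mkcond; apply: eq_bigr => c _;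
    case: (_ \in C s).
by apply: fsubset_leq_card; apply/fsubsetP => g; rewrite !inE => /andP[].
Qed.

Lemma bdr_folner (bdr : {fset G} -> {fset G}) (S : {fset G}) (dl : R) : 0 < dl ->
  (forall A g, g \in bdr A -> exists2 s, s \in S & g \in symdiff A (ltrans s^-1%g A)) ->
  exists N, forall n, (N <= n)%N -> #|` bdr (F n)|%:R <= dl * #|` F n|%:R.
Proof.
move=> dl0 Hbdr; pose e := dl / (#|` S|.+1)%:R.
have e0 : 0 < e by rewrite divr_gt0.
have H : \forall n \near \oo, (\bigcap_(s in [set` S])
    [set n | #|` symdiff (F n) (ltrans s^-1%g (F n))|%:R < e * #|` F n|%:R]) n.
  by apply: filter_bigI => s _; exact: symdiff_ltrans_lt.
have [N _ HN] := H; exists N => n Nn.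
apply: (@le_trans _ _ (\sum_(s <- S) #|` symdiff (F n) (ltrans s^-1%g (F n))|)%:R).
  by rewrite ler_nat; apply: card_fset_le_sum => g; exact: Hbdr.
rewrite natr_sum; apply: (@le_trans _ _ (\sum_(s <- S) e * #|` F n|%:R)).
  by rewrite big_seq [leRHS]big_seq; apply: ler_sum => s sS; apply/ltW/(HN n Nn).
rewrite big_const_seq count_predT iter_addr_0 -[leLHS]mulr_natl mulrA.
by rewrite ler_wpM2r // /e mulrA ler_pdivrMr // mulrC ler_pM2l // ler_nat.
Qed.

Lemma outer_bdr_folner S (dl : R) : 0 < dl ->
  exists N, forall n, (N <= n)%N -> #|` outer_bdr S (F n)|%:R <= dl * #|` F n|%:R.
Proof.
move=> dl0; apply: (bdr_folner (S := S)) => // A g.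
case/outer_bdrP => s sS [sgA gA]; exists s => //.
by apply: in_symdiff_ltrans; rewrite sgA (negbTE gA).
Qed.

Lemma inner_bdr_folner S (dl : R) : 0 < dl ->
  exists N, forall n, (N <= n)%N -> #|` inner_bdr S (F n)|%:R <= dl * #|` F n|%:R.
Proof.
move=> dl0; apply: (bdr_folner (S := S)) => // A g.
case/inner_bdrP => s sS [gA sgA]; exists s => //.
by apply: in_symdiff_ltrans; rewrite gA (negbTE sgA).
Qed.

Variable phi : {fset G} -> R.
Hypothesis phi_ge0 : forall A, 0 <= phi A.
Hypothesis phi0 : phi fset0 = 0.
Hypothesis phiU : forall A B, phi (A `|` B)%fset <= phi A + phi B.
Hypothesis phi_rtrans : forall A c, phi (rtrans A c) <= phi A.
Variable M : R.
Hypothesis phi_le : forall A, phi A <= M * #|` A|%:R.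

Let F0 n : F n != fset0. Proof. by case: F_folner. Qed.
Let cF0 n : 0 < #|` F n|%:R :> R. Proof. by rewrite ltr0n cardfs_gt0. Qed.

(** The infimum of these [lam] is the lower limit of [phi (F n) / #|F n|]. *)
Definition frequently_le (lam : R) :=
  forall N, exists2 n, (N <= n)%N & phi (F n) <= lam * #|` F n|%:R.

(** Each new tile is taken far enough along the sequence to be nearly invariant under those already
    chosen, and is put at the head, where [quasi_tiling] uses it first. *)
Lemma exists_tiles (lam dl : R) k : 0 < dl -> frequently_le lam ->
  exists Es : seq {fset G}, [/\ size Es = k,
    forall E, E \in Es -> E != fset0 /\ phi E <= lam * #|` E|%:R &
    pairwise (fun E S => #|` outer_bdr S E|%:R <= dl * #|` E|%:R) Es].
Proof.
move=> dl0 fr; elim: k => [|k [Es [szE HE pE]]]; first by exists [::].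
have [N HN] : exists N, forall S, S \in Es -> forall n, (N <= n)%N ->
    #|` outer_bdr S (F n)|%:R <= dl * #|` F n|%:R.
  elim: (Es) => [|S s [N HN]]; first by exists 0%N.
  have [N' HN'] := outer_bdr_folner S dl0.
  exists (maxn N N') => T; rewrite inE => /orP[/eqP ->|Ts] n.
    by rewrite geq_max => /andP[_]; exact: HN'.
  by rewrite geq_max => /andP[+ _]; exact: HN.
have [n Nn phin] := fr N; exists (F n :: Es); split; first by rewrite /= szE.
  by move=> E; rewrite inE => /orP[/eqP ->|/HE //]; split; first exact: F0.
by rewrite pairwise_cons pE andbT; apply/allP => S SEs; exact: HN.
Qed.

Lemma eventually_le (lam eps : R) : frequently_le lam -> 0 < eps ->
  exists N, forall n, (N <= n)%N -> phi (F n) <= (lam + eps) * #|` F n|%:R.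
Proof.
move=> fr eps0.
have lam0 : 0 <= lam.
  have [n _] := fr 0%N; move=> /(le_trans (phi_ge0 _)).
  by rewrite pmulr_lge0.
have M0 : 0 <= M.
  by have := le_trans (phi_ge0 _) (phi_le (F 0%N)); rewrite pmulr_lge0.
(* The tiled part contributes [lam / (1 - eta) <= lam * (1 + 2 * eta)] and the rest at most
   [M * eta]. *)
pose eta := Num.min (2^-1) (eps / (2 * lam + M + 1)).
have den0 : 0 < 2 * lam + M + 1 by lra.
have eta0 : 0 < eta by rewrite lt_min invr_gt0 ltr0n divr_gt0.
have eta12 : eta <= 2^-1 by rewrite ge_min lexx.
have etae : eta * (2 * lam + M + 1) <= eps.
  by rewrite -ler_pdivlMr // ge_min lexx orbT.
have [k hk] : exists k, (1 - eta / 2) ^+ k <= eta.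
  have [k hk] := expRN_small 1 (divr_gt0 eta0 (ltr0n R 2)) eta0; exists k.
  apply: le_trans hk; rewrite mul1r (_ : - (_ * k%:R) = k%:R * - (eta / 2)); last by ring.
  rewrite expRM_natl.
  have e1 : 0 <= 1 - eta / 2 by move: eta12; lra.
  by apply: lerXn2r; rewrite ?nnegrE ?expR_ge0 ?expR_ge1Dx.
(* Solves [dl + 2 * dl * k = eta / 2], the budget of [quasi_tiling] with [b = dl]. *)
pose dl := eta / 2 / (1 + 2 * k%:R).
have dl0 : 0 < dl by rewrite divr_gt0 ?divr_gt0 // ltr_pwDl // mulr_ge0.
have [Es [szE HE pE]] := exists_tiles k dl0 fr.
have [N HN] : exists N, forall S, S \in Es -> forall n, (N <= n)%N ->
    #|` inner_bdr S (F n)|%:R <= dl * #|` F n|%:R.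
  elim: (Es) => [|S s [N HN]]; first by exists 0%N.
  have [N' HN'] := inner_bdr_folner S dl0.
  exists (maxn N N') => T; rewrite inE => /orP[/eqP ->|Ts] n.
    by rewrite geq_max => /andP[_]; exact: HN'.
  by rewrite geq_max => /andP[+ _]; exact: HN.
exists N => n Nn.
have eta1 : 0 < 1 - eta by lra.
have HEs E : E \in Es -> [/\ E != fset0, phi E <= lam * #|` E|%:R &
    #|` inner_bdr E (F n `\` fset0)%fset|%:R <= dl * #|` F n|%:R].
  by move=> EEs; have [E0 phiE] := HE E EEs; rewrite fsetD0; split=> //; exact: HN.
have bd : dl + 2 * dl * (size Es)%:R <= eta / 2.
  rewrite szE (_ : dl + _ = dl * (1 + 2 * k%:R)); last by ring.
  by rewrite divfK // gt_eqF // ltr_pwDl // mulr_ge0.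
have phiD0 : phi fset0 <= lam / (1 - eta) * #|` (fset0 : {fset G})|%:R.
  by rewrite phi0 cardfs0 mulr0.
have [D [DA phiD cD]] := quasi_tiling phi0 phiU phi_rtrans lam0 eta0 eta12
  (ltW dl0) HEs pE bd (fsub0set _) phiD0.
have cD' : #|` (F n `\` D)%fset|%:R <= eta * #|` F n|%:R.
  apply: (le_trans cD); rewrite ge_max lexx /= fsetD0 szE.
  by rewrite ler_wpM2r.
have FD : F n = (D `|` (F n `\` D))%fset.
  by apply/fsetP => g; rewrite !inE; case: (boolP (g \in D)) => //= /(fsubsetP DA).
rewrite [X in phi X]FD; apply: (le_trans (phiU _ _)).
have cDA : #|` D|%:R <= #|` F n|%:R :> R by rewrite ler_nat fsubset_leq_card.
have h1 : phi D <= lam * (1 + 2 * eta) * #|` F n|%:R.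
  apply: (le_trans phiD); apply: ler_pM => //; first by rewrite divr_ge0 // ltW.
  by rewrite ler_wpM2l // -div1r ler_pdivrMr //; nra.
have h2 : phi (F n `\` D)%fset <= M * (eta * #|` F n|%:R).
  by apply: (le_trans (phi_le _)); rewrite ler_wpM2l.
apply: (le_trans (lerD h1 h2)).
rewrite mulrA -mulrDl ler_wpM2r //; lra.
Qed.

Lemma ornstein_weiss : cvgn (fun n => phi (F n) / #|` F n|%:R : R).
Proof.
have lam0 lam : frequently_le lam -> 0 <= lam.
  move=> /(_ 0%N) [n _] /(le_trans (phi_ge0 _)).
  by rewrite pmulr_lge0.
pose l := inf frequently_le.
have hasE : has_inf frequently_le.
  split; first by exists M => N; exists N.
  by exists 0 => lam /lam0.
apply/cvg_ex; exists l; apply/cvgrPdist_le => e e0.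
have [lam lamE lam_lt] := inf_adherent (divr_gt0 e0 (ltr0n R 2)) hasE.
have [N HN] := eventually_le lamE (divr_gt0 e0 (ltr0n R 2)).
have [N' HN'] : exists N', forall n, (N' <= n)%N -> (l - e) * #|` F n|%:R < phi (F n).
  apply: contrapT => /forallNP H.
  have : frequently_le (l - e).
    move=> N'; have /existsNP [n /not_implyP [N'n /negP]] := H N'.
    by rewrite -leNgt; exists n.
  by move=> /(ge_inf hasE.2); lra.
exists (maxn N N') => // n /=; rewrite geq_max => /andP[/HN h /HN' h'].
rewrite ler_distlC; apply/andP; split.
  by rewrite ler_pdivlMr // ltW.
rewrite ler_pdivrMr //; apply: le_trans h _; rewrite ler_wpM2r //.
by rewrite -/l in lam_lt; lra.
Qed.

End OrnsteinWeiss.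

(** * Conditional covering numbers *)

Section CoverNumbers.
Variables (R : realType) (G : groupType) (X : topologicalType).
Variables (act : G -> X -> X) (F : nat -> {fset G}).
Hypothesis actP : continuous_action act.
Hypothesis F_folner : folner R F.
Variable x0 : X.
Variables (U V : set (set X)).
Hypotheses (covU : finite_open_cover U) (covV : finite_open_cover V).
Implicit Types (A E : {fset G}) (B : set X) (k : nat).

Definition covered_by E k : Prop := forall B, join_cover act V E B ->
  exists S : {fset set X}, [/\ [set` S] `<=` join_cover act U E,
    B `<=` \bigcup_(C in [set` S]) C & (#|` S| <= k)%N].

Lemma covered_byU A E k l : covered_by A k -> covered_by E l ->
  covered_by (A `|` E)%fset (k * l).
Proof.
move=> HA HE _ [c Vc <-].
have [|S [SU BS Sk]] := HA (\bigcap_(g in [set` A]) (act g @^-1` c g)).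
  by exists c => // g gA; apply: Vc; rewrite inE gA.
have [|T [TU BT Tl]] := HE (\bigcap_(g in [set` E]) (act g @^-1` c g)).
  by exists c => // g gE; apply: Vc; rewrite inE gE orbT.
have pick C C' : exists D, C \in S -> C' \in T ->
    join_cover act U (A `|` E)%fset D /\ C `&` C' `<=` D.
  have [CS|CS] := boolP (C \in S); last by exists set0.
  have [CT|CT] := boolP (C' \in T); last by exists set0.
  have [[c1 Uc1 <-] [c2 Uc2 <-]] := (SU _ CS, TU _ CT).
  pose c3 g := if g \in A then c1 g else c2 g.
  exists (\bigcap_(g in [set` (A `|` E)%fset]) (act g @^-1` c3 g)) => _ _; split.
    exists c3 => // g; rewrite inE /c3; case: ifP => [gA _|_ /= gE]; first exact: Uc1.
    exact: Uc2.
  move=> x [H1 H2] g; rewrite /= inE /c3; case: ifP => [gA _|_ /= gE]; first exact: H1.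
  exact: H2.
pose d C C' := sval (cid (pick C C')); have dP C C' := svalP (cid (pick C C')).
exists (seq_fset tt [seq d C C' | C <- S, C' <- T]); split.
- move=> D; rewrite mksetE seq_fsetE => /allpairsP [[C C'] [/= CS CT ->]].
  by case: (dP C C' CS CT).
- move=> x Bx.
  have [|C CS Cx] := BS x; first by move=> g gA; apply: Bx; rewrite /= inE gA.
  have [|C' CT C'x] := BT x; first by move=> g gE; apply: Bx; rewrite /= inE gE orbT.
  exists (d C C'); last by apply: (dP C C' CS CT).2.
  by rewrite mksetE seq_fsetE; apply/allpairsP; exists (C, C').
rewrite size_seq_fset; apply: leq_trans (size_undup _) _.
by rewrite size_allpairs leq_mul.
Qed.

(** Since [act (g * c) x = act g (act c x)], pulling back by [act c] turns joins over [A] into joins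
    over the right translate; this is why the tilings use right translates. *)
Lemma covered_by_rtrans A c k : covered_by A k -> covered_by (rtrans A c) k.
Proof.
have [_ actM _] := actP; move=> HA _ [d Vd <-].
have [|S [SU BS Sk]] := HA (\bigcap_(g in [set` A]) (act g @^-1` d (g * c)%g)).
  exists (fun g => d (g * c)%g) => // g gA; apply: Vd.
  by apply/imfsetP; exists g.
exists [fset (act c @^-1` C)%classic | C in S]%fset; split.
- move=> _ /imfsetP [C /= /SU [c1 Uc1 <-] ->]; exists (fun g => c1 (g * c^-1)%g).
    by move=> _ /imfsetP [g /= gA ->]; rewrite mulgK; exact: Uc1.
  apply/seteqP; split=> x /= H g.
    move=> gA; rewrite /= -actM; have := H (g * c)%g; rewrite /= mulgK; apply.
    by apply/imfsetP; exists g.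
  by move=> /imfsetP [h /= hA ->]; rewrite /= mulgK actM; exact: H.
- move=> x Bx; have [|C CS Cx] := BS (act c x).
    move=> g gA; rewrite /= -actM; apply: Bx.
    by apply/imfsetP; exists g.
  by exists (act c @^-1` C) => //; apply/imfsetP; exists C.
by apply: leq_trans (leq_imfset_card _ _ _) _.
Qed.

Lemma covered_by0 : covered_by fset0 1.
Proof.
move=> B _; exists [fset setT]%fset; split; last by rewrite cardfs1.
  move=> _ /= /fset1P ->; exists (fun=> set0) => //.
  by apply/seteqP; split=> // x _ g.
by move=> x _; exists setT => //=; rewrite inE.
Qed.

Lemma covered_by1 g : covered_by [fset g]%fset #|` fset_set U|.
Proof.
have [finU _ Ucov] := covU => B _.
exists [fset (act g @^-1` C)%classic | C in fset_set U]%fset; split.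
- move=> _ /imfsetP [C /= + ->]; rewrite in_fset_set // => /set_mem UC.
  exists (fun=> C) => //; apply/seteqP; split=> [x H|x Cx h].
    by apply: H; rewrite /= inE.
  by rewrite /= inE => /eqP ->.
- move=> x _; have [C UC Cx] := finite_cover_member (act g x) covU.
  exists (act g @^-1` C) => //; apply/imfsetP; exists C => //=.
  by rewrite in_fset_set // mem_set.
by apply: leq_trans (leq_imfset_card _ _ _) _.
Qed.

(** The join of [V] has a member containing [x0], which no empty family covers; the logarithms below
    are thus taken of positive numbers. *)
Lemma covered_by_gt0 E k : covered_by E k -> (0 < k)%N.
Proof.
pose c g := sval (cid2 (finite_cover_member (act g x0) covV)).
have cP g : V (c g) /\ c g (act g x0) by rewrite /c; case: cid2.
move=> /(_ (\bigcap_(g in [set` E]) (act g @^-1` c g))) [|S [_ BS]].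
  by exists c => // g _; case: (cP g).
apply: leq_trans; rewrite cardfs_gt0; apply/fset0Pn.
have [|C CS _] := BS x0; first by move=> g _; case: (cP g).
by exists C.
Qed.

Lemma covered_by_exp A : covered_by A (#|` fset_set U| ^ #|` A|).
Proof.
elim/finSet_rect: A => A IH.
have [->|/fset0Pn [g gA]] := eqVneq A fset0.
  by rewrite cardfs0 expn0; exact: covered_by0.
rewrite -(fsetD1K gA) cardfsU1 !inE eqxx /= expnS.
apply: covered_byU; first exact: covered_by1.
by apply: IH; exact: fproperD1.
Qed.

Lemma ex_covered_by A : exists k, `[< covered_by A k >].
Proof. by exists (#|` fset_set U| ^ #|` A|)%N; apply/asboolP/covered_by_exp. Qed.

Definition min_cover A : nat := ex_minn (ex_covered_by A).

Lemma min_coverP A : covered_by A (min_cover A).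
Proof. by rewrite /min_cover; case: ex_minnP => k /asboolP. Qed.

Lemma min_cover_le A k : covered_by A k -> (min_cover A <= k)%N.
Proof. by rewrite /min_cover; case: ex_minnP => l _ H /asboolT /H. Qed.

Lemma cond_cover_numE A :
  cond_cover_num R (join_cover act U A) (join_cover act V A) = (min_cover A)%:R%:E.
Proof.
apply/eqP; rewrite eq_le; apply/andP; split.
  apply: ge_ereal_sup => _ [B VB <-]; have [S [SU BS Sk]] := min_coverP VB.
  apply: (@le_trans _ _ (#|` S|%:R)%:E); last by rewrite lee_fin ler_nat.
  by apply: ereal_inf_lbound; exists S.
case E : (min_cover A) => [|k].
  have [B VB] : exists B, join_cover act V A B.
    pose c g := sval (cid2 (finite_cover_member (act g x0) covV)).
    have cP g : V (c g) by rewrite /c; case: cid2.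
    by exists (\bigcap_(g in [set` A]) (act g @^-1` c g)), c.
  apply: (@le_trans _ _ (cover_num R (join_cover act U A) B)); last first.
    by apply: ereal_sup_ubound; exists B.
  by apply: le_ereal_inf_tmp => _ [S _ <-]; rewrite lee_fin.
have : ~ covered_by A k by move=> /min_cover_le; rewrite E ltnn.
move=> /existsNP [B /not_implyP [VB /forallNP H]].
apply: (@le_trans _ _ (cover_num R (join_cover act U A) B)); last first.
  by apply: ereal_sup_ubound; exists B.
apply: le_ereal_inf_tmp => _ [S [SU BS] <-]; rewrite lee_fin ler_nat ltnNge.
by apply/negP => Sk; apply: (H S).
Qed.

Definition log_cover A : R := ln (min_cover A)%:R.

Lemma lne_cond_cover_num A :
  lne (cond_cover_num R (join_cover act U A) (join_cover act V A)) = (log_cover A)%:E.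
Proof.
rewrite cond_cover_numE /= lern0 -leqn0 leqNgt.
by rewrite (covered_by_gt0 (@min_coverP A)).
Qed.

Lemma log_cover_ge0 A : 0 <= log_cover A.
Proof. by rewrite ln_ge0 // ler1n (covered_by_gt0 (@min_coverP A)). Qed.

Lemma log_cover_le A k : covered_by A k -> log_cover A <= ln k%:R.
Proof.
move=> Ak; rewrite ler_ln ?posrE ?ltr0n ?ler_nat ?min_cover_le //.
  exact: covered_by_gt0 (@min_coverP A).
exact: covered_by_gt0 Ak.
Qed.

Lemma cvg_log_cover : cvgn (fun n => log_cover (F n) / #|` F n|%:R : R).
Proof.
apply: (@ornstein_weiss R G F F_folner log_cover _ _ _ _ (ln #|` fset_set U|%:R)).
- exact: log_cover_ge0.
- apply/eqP; rewrite eq_le log_cover_ge0 andbT.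
  by apply: le_trans (log_cover_le covered_by0) _; rewrite ln1.
- move=> A B.
  apply: (le_trans (log_cover_le (covered_byU (@min_coverP A) (@min_coverP B)))).
  rewrite natrM lnM // posrE ltr0n; exact: covered_by_gt0 (@min_coverP _).
- by move=> A c; apply: log_cover_le; apply: covered_by_rtrans; exact: min_coverP.
move=> A; apply: (le_trans (log_cover_le (@covered_by_exp A))).
rewrite natrX lnXn ?mulr_natr // ltr0n.
exact: covered_by_gt0 (@covered_by1 1%g).
Qed.

Lemma cond_entropyE : cond_entropy R act F U V =
  (limn (fun n => log_cover (F n) / #|` F n|%:R))%:E.
Proof.
rewrite -EFin_lim; last exact: cvg_log_cover.
congr (limn _); apply/funext => n /=.
by rewrite lne_cond_cover_num -EFinM mulrC.
Qed.

Lemma cond_entropy_ge0 : (0 <= cond_entropy R act F U V)%E.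
Proof.
rewrite cond_entropyE lee_fin; apply: limr_ge; first exact: cvg_log_cover.
by near=> n; rewrite divr_ge0 // log_cover_ge0.
Unshelve. all: by end_near. Qed.

Lemma cond_entropy_lt (b : R) : (cond_entropy R act F U V < b%:E)%E ->
  exists N, forall n, (N <= n)%N ->
    exists2 k, covered_by (F n) k & k%:R <= expR (b * #|` F n|%:R).
Proof.
rewrite cond_entropyE lte_fin => /(cvgr_lt _ cvg_log_cover) [N _ HN].
exists N => n /HN /= lt_b; exists (min_cover (F n)); first exact: min_coverP.
have k0 : 0 < (min_cover (F n))%:R :> R.
  by rewrite ltr0n (covered_by_gt0 (@min_coverP _)).
rewrite -(@lnK R _ k0) ler_expR -ler_pdivrMr ?ltr0n ?cardfs_gt0; first exact: ltW.
by case: F_folner.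
Qed.

End CoverNumbers.

(** * Passing from one cover to another *)

Section Refine.
Variables (R : realType) (G : groupType) (X : topologicalType).
Variables (act : G -> X -> X) (F : nat -> {fset G}).
Local Notation word := {fmap G -> set X}.
Local Notation D := (@deep_words G X F).
Implicit Types (U V : set (set X)) (u v : word) (s t b : R).

Lemma words_join_cover U E B : join_cover act U E B ->
  exists2 u, words U E u & word_set act u = B.
Proof.
by move=> [c Uc <-]; exists (mkword E c);
  [exact: words_mkword|exact: word_set_mkword].
Qed.

Lemma join_cover_words U E u : words U E u -> join_cover act U E (word_set act u).
Proof. by move=> /(word_setE act) [c Uc ->]; exists c. Qed.

(** A word over [F j] is replaced by at most [expR (b * #|F j|)] words of [U], which the increase
    [b] of the exponent compensates exactly. *)
Lemma null_refine U V L t b :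
  (exists N, forall n, (N <= n)%N ->
    exists2 k, covered_by act U V (F n) k & k%:R <= expR (b * #|` F n|%:R)) ->
  null act F L V t -> null act F L U (t + b).
Proof.
move=> [N0 HN] nL N e e0.
have [Lam [LamD LLam Lame]] := nL (maxn N N0) e e0.
have ref v : exists W : seq word, Lam v -> [/\ forall u, u \in W -> D U N u,
    word_set act v `<=` \bigcup_(u in [set` W]) word_set act u &
    \sum_(u <- W) weight (t + b) u <= weight t v].
  have [Lv|nLv] := pselect (Lam v); last by exists [::].
  have [j /= Nj vj] := LamD v Lv.
  have [k Hk kb] := HN j (leq_trans (leq_maxr _ _) Nj).
  have [S [SU vS Sk]] := Hk _ (join_cover_words vj).
  have wS C : exists u, C \in S -> words U (F j) u /\ word_set act u = C.
    have [CS|] := boolP (C \in S); last by exists v.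
    by have [u ? ?] := words_join_cover (SU C CS); exists u.
  pose w C := sval (cid (wS C)); have wP C := svalP (cid (wS C)).
  exists [seq w C | C <- S] => _; split.
  - move=> u /mapP [C CS ->]; exists j; last exact: (wP C CS).1.
    exact: leq_trans (leq_maxl _ _) Nj.
  - move=> x /vS [C CS Cx]; exists (w C); first by apply/mapP; exists C.
    by rewrite (wP C CS).2.
  rewrite big_map big_seq (eq_bigr (fun=> expR (- ((t + b) * #|` F j|%:R)))); last first.
    by move=> C CS; rewrite /weight /word_len (wP C CS).1.1.
  rewrite -big_seq big_const_seq count_predT iter_addr_0 -[leLHS]mulr_natl.
  rewrite /weight /word_len vj.1.
  apply: (@le_trans _ _ (expR (b * #|` F j|%:R) * expR (- ((t + b) * #|` F j|%:R)))).
    by rewrite ler_wpM2r ?expR_ge0 // (le_trans _ kb) // ler_nat.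
  by rewrite -expRD ler_expR le_eqVlt; apply/orP; left; apply/eqP; ring.
pose W v := sval (cid (ref v)); have WP v := svalP (cid (ref v)).
exists (\bigcup_(v in Lam) [set` W v]); split.
- by move=> u [v Lv uW]; have [+ _ _] := WP v Lv; exact.
- move=> x /LLam [v Lv /((and3_rec (fun _ H _ => H) (WP v Lv)) x) [u uW xu]].
  by exists u => //; exists v.
move=> A AW.
(* Each refined word is charged to one parent in [Lam], so a finite family of them is paid for by
   finitely many parents. *)
have pk u : exists v, u \in A -> Lam v /\ u \in W v.
  have [uA|] := boolP (u \in A); last by exists u.
  by have [v Lv uW] := AW u uA; exists v.
pose p u := sval (cid (pk u)); have pP u := svalP (cid (pk u)).
pose A' := [fset p u | u in A]%fset.
have A'L : [set` A'] `<=` Lam by move=> _ /imfsetP [u /= uA ->]; case: (pP u uA).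
apply: le_trans (Lame A' A'L).
apply: (@le_trans _ _ (\sum_(v <- A') \sum_(u <- A | u \in W v) weight (t + b) u)).
  rewrite (exchange_big_dep xpredT) //= big_seq [leRHS]big_seq.
  apply: ler_sum => u uA; have pA' : p u \in A' by apply/imfsetP; exists u.
  rewrite big_mkcond (big_rem (p u) pA') /= (pP u uA).2 lerDl sumr_ge0 // => v _.
  by case: ifP => // _; exact: weight_ge0.
rewrite big_seq [leRHS]big_seq; apply: ler_sum => v /A'L Lv.
have [_ _ WS] := WP v Lv; apply: le_trans WS.
rewrite -big_filter; apply: ler_sum_subseq.
- by move=> u; exact: weight_ge0.
- by rewrite filter_uniq // fset_uniq.
- by move=> u; rewrite mem_filter => /andP[].
Qed.

End Refine.

(** * Conclusion *)

Lemma exists_closed_star (R : realType) (X : metricType R) (U : set (set X)) :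
  compact [set: X] -> finite_open_cover U ->
  exists V, finite_open_cover V /\ forall A, V A -> exists2 A', U A' &
    forall B, V B -> A `&` B !=set0 -> closure B `<=` A'.
Proof.
move=> cX covU; have [_ oU _] := covU.
have rad (x : X) : exists eA : {posnum R} * set X,
    U eA.2 /\ ball x (eA.1%:num + eA.1%:num) `<=` eA.2.
  have [A UA Ax] := finite_cover_member x covU.
  have /nbhs_ballP [e /= e0 eA] : nbhs x A by apply: open_nbhs_nbhs; split=> //; exact: oU.
  by exists (PosNum (divr_gt0 e0 (ltr0n R 2)), A); split=> //=; rewrite -splitr.
pose ep x := (sval (cid (rad x))).1; pose Ap x := (sval (cid (rad x))).2.
have ep0 x : 0 < (ep x)%:num by [].
have radP x : U (Ap x) /\ ball x ((ep x)%:num + (ep x)%:num) `<=` Ap x := svalP (cid (rad x)).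
have [x _|x _|Z _ ZX] := @compact_finite_subcover X setT X setT
    (fun x => (ball x (ep x)%:num)^°) cX.
- exact: open_interior.
- by exists x => //; exact: nbhsx_ballx.
have min_ep (xs : seq X) : exists e : R, 0 < e /\ forall x, x \in xs -> e <= (ep x)%:num.
  elim: xs => [|x s [e [e0 es]]]; first by exists 1.
  exists (Num.min e (ep x)%:num); split; first by rewrite lt_min e0 ep0.
  move=> y; rewrite inE ge_min => /orP[/eqP ->|/es ->//].
  by rewrite lexx orbT.
have [e [e0 eZ]] := min_ep Z.
(* From the centre [y] to a point in the closure of a ball meeting the one at [y] there are four
   steps of length [d], and [4 * d = e] is at most every selected radius. *)
pose d := e / 4; have d0 : 0 < d by rewrite divr_gt0.
have [x _|x _|Y _ YX] := @compact_finite_subcover X setT X setT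
    (fun x => (ball x d)^°) cX.
- exact: open_interior.
- by exists x => //; exact: nbhsx_ballx.
exists [set (ball y d)^° | y in [set` Y]]; split; first split.
- by apply: finite_image; exact: finite_fset.
- by move=> _ [y _ <-]; exact: open_interior.
- apply/seteqP; split=> // x _; have [y yY xy] := YX x I.
  by exists (ball y d)^° => //; exists y.
move=> _ [y yY <-]; have [x xZ /interior_subset xy] := ZX y I.
have [UA Ax] := radP x.
exists (Ap x) => // _ [z zY <-] [q [/interior_subset yq /interior_subset zq]] p pz.
have [r [/interior_subset zr pr]] := pz _ (nbhsx_ballx p d d0).
apply: Ax; apply: (@le_ball _ _ _ ((ep x)%:num + (d + d + (d + d)))).
  rewrite lerD2l (le_trans _ (eZ x xZ)) // /d.
  by rewrite le_eqVlt; apply/orP; left; apply/eqP; field.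
apply: ball_triangle xy _; apply: (ball_triangle (y := z)).
  by apply: ball_triangle yq _; exact: ball_sym.
by apply: ball_triangle zr _; exact: ball_sym.
Qed.

Section Assembly.
Variables (R : realType) (G : groupType) (X : metricType R).
Variables (act : G -> X -> X) (F : nat -> {fset G}).
Hypothesis X_compact : compact [set: X].
Hypothesis actP : continuous_action act.
Hypothesis F_folner : folner R F.
Hypothesis F_incr : forall n, (F n `<=` F n.+1)%fset.
Hypothesis F_unbounded : forall m, exists N, forall n, (N <= n)%N -> (m <= #|` F n|)%N.
Variable x0 : X.
Implicit Types (U V : set (set X)) (K L : set X) (s t b : R).

Lemma bowen_entropyS K L : K `<=` L ->
  (bowen_entropy R act F K <= bowen_entropy R act F L)%E.
Proof.
move=> KL; apply: ge_ereal_sup => _ [U covU <-].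
apply: (@le_trans _ _ (bowen_entropy_cover R act F L U)); last first.
  by apply: ereal_sup_ubound; exists U.
apply: le_ereal_inf => _ [s [s0 /bowen_measure_eq0 Ls] <-]; exists s => //.
by split=> //; apply/bowen_measure_eq0; exact: nullW Ls.
Qed.

Lemma bowen_entropy_le K (s : R) : 0 <= s ->
  (forall U, finite_open_cover U -> null act F K U s) ->
  (bowen_entropy R act F K <= s%:E)%E.
Proof.
move=> s0 H; apply: ge_ereal_sup => _ [U covU <-].
by apply: bowen_entropy_cover_le => //; exact: H.
Qed.

Lemma bowen_entropy_null K U (s e : R) : finite_open_cover U ->
  (bowen_entropy R act F K <= s%:E)%E -> 0 < e -> null act F K U (s + e).
Proof.
move=> covU Ks e0; apply: bowen_entropy_cover_lt.
apply: (@le_lt_trans _ _ (bowen_entropy R act F K)).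
  by apply: ereal_sup_ubound; exists U.
by apply: (le_lt_trans Ks); rewrite lte_fin ltrDl.
Qed.

Lemma bowen_entropy_bigcup (Ki : nat -> set X) (s : R) : 0 <= s ->
  (forall i, bowen_entropy R act F (Ki i) <= s%:E)%E ->
  (bowen_entropy R act F (\bigcup_i Ki i) <= s%:E)%E.
Proof.
move=> s0 H; apply/lee_addgt0Pr => e e0; rewrite -EFinD.
apply: bowen_entropy_le; first by rewrite addr_ge0 // ltW.
by move=> U covU; apply: null_bigcup => i; exact: bowen_entropy_null.
Qed.

Lemma finite_open_cover_setT : @finite_open_cover X [set setT].
Proof.
split; [exact: finite_set1|by move=> A ->; exact: openT|].
by rewrite bigcup_set1.
Qed.

Lemma bowen_entropy_ge0 K : (0 <= bowen_entropy R act F K)%E.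
Proof.
apply: (@le_trans _ _ (bowen_entropy_cover R act F K [set setT])).
  exact: bowen_entropy_cover_ge0.
by apply: ereal_sup_ubound; exists [set setT] => //; exact: finite_open_cover_setT.
Qed.

Lemma bowen_entropy_set1 : (bowen_entropy R act F [set x0] <= 0)%E.
Proof.
apply/lee_addgt0Pr => s s0; rewrite add0e; apply: bowen_entropy_le; first exact: ltW.
move=> U covU N e e0; have [m me] := expRN_small 1 s0 e0.
have [N' HN'] := F_unbounded m; pose j := maxn N N'.
have [u uj xu] := @word_cover _ _ act U (F j) covU x0 I.
apply: (@cheap_seq _ _ _ _ _ _ _ _ _ [:: u]).
- move=> w; rewrite inE => /eqP ->; exists j => //; exact: leq_maxl.
- by move=> _ ->; exists u => //=; rewrite inE.
rewrite big_seq1; apply: le_trans me; rewrite mul1r ler_expR lerN2 ler_pM2l //.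
by rewrite ler_nat /word_len uj.1 HN' // leq_maxr.
Qed.

Lemma tail_entropy_ge0 : (0 <= tail_entropy R act F)%E.
Proof.
apply: le_ereal_inf_tmp => _ [V covV <-].
apply: (@le_trans _ _ (cond_entropy R act F V V)).
  exact (cond_entropy_ge0 actP F_folner x0 covV covV).
by apply: ereal_sup_ubound; exists V.
Qed.

Lemma tail_entropy_lt (b : R) : (tail_entropy R act F < b%:E)%E ->
  exists2 U, finite_open_cover U &
    forall W, finite_open_cover W -> (cond_entropy R act F W U < b%:E)%E.
Proof.
move=> /ereal_inf_lt [_ [U covU <-] Ub]; exists U => // W covW.
by apply: le_lt_trans Ub; apply: ereal_sup_ubound; exists W.
Qed.

Lemma null_bowen_entropy_le L U t b : finite_open_cover U ->
  (forall W, finite_open_cover W -> (cond_entropy R act F W U < b%:E)%E) ->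
  0 <= t -> null act F L U t -> (bowen_entropy R act F L <= (t + b)%:E)%E.
Proof.
move=> covU Ub t0 Lt.
have b0 : 0 <= b.
  rewrite -lee_fin; apply: le_trans (ltW (Ub U covU)).
  exact (cond_entropy_ge0 actP F_folner x0 covU covU).
apply: bowen_entropy_le; first exact: addr_ge0.
move=> W covW; apply: null_refine Lt.
exact (cond_entropy_lt actP F_folner x0 covW covU (Ub W covW)).
Qed.

Lemma exists_lowered K U s s' t : souslin K -> finite_open_cover U ->
  0 < s -> s < s' -> s < t -> ~ null act F K U s' ->
  exists L, [/\ L `<=` K, null act F L U t & (s%:E <= bowen_entropy R act F L)%E].
Proof.
move=> souK covU s0 ss' st nK.
have [finU oU _] := covU; have [_ _ actC] := actP.
have [N [c [c0 nKc]]] : exists N c, 0 < c /\ ~ cheap act F K U N s' c.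
  apply: contrapT => H; apply: nK => N c c0; apply: contrapT => nc.
  by apply: H; exists N, c.
(* Exponent is lost twice: down to the midpoint in the reduction to a compact set, and from there to
   [s] for the Frostman functional. *)
have s1s' : (s + s') / 2 < s' by lra.
have ss1 : s < (s + s') / 2 by lra.
have c2 : c / 2 < c by lra.
have c20 : 0 < c / 2 by lra.
have [K1 [K1K cK1 nK1]] := souslin_compact F_incr F_unbounded actC finU oU souK
  s1s' (ltW c20) c2 nKc.
have [V [covV starUV]] := exists_closed_star X_compact covU.
have [finV _ _] := covV.
have star : star_points U V.
  move=> y; have [A VA Ay] := finite_cover_member y covV.
  have [A' UA' H] := starUV A VA; exists A' => // B VB By.
  by apply: subset_trans (H B VB _); [exact: subset_closure|exists y].
have [l [fl lT lK lr]] := frostman_words F_incr F_unbounded finV star c20 ss1 nK1.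
have B0 := frostman_const_gt0 c20 ss1.
have lF := And3 fl lK lr.
have [L [LK1 LU LV]] := lowering F_incr F_unbounded actC covV starUV s0 B0 cK1 lF lT st.
exists L; split=> //; first exact: subset_trans K1K.
apply: (@le_trans _ _ (bowen_entropy_cover R act F L V)); last first.
  by apply: ereal_sup_ubound; exists V.
rewrite leNgt; apply/negP => /bowen_entropy_cover_lt /(_ N) H.
by apply: LV; apply: H; rewrite divr_gt0 // invr_gt0.
Qed.

End Assembly.

Local Open Scope ereal_scope.

Theorem theorem1p3 (R : realType) (X : metricType R) (G : groupType)
    (act : G -> X -> X) (F : nat -> {fset G}) (K : set X)
    (X_compact : compact [set: X])
    (G_countable : countable [set: G]) (G_infinite : infinite_set [set: G])
    (G_amenable : amenable R G)
    (act_cont : continuous_action act)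
    (F_folner : folner R F)
    (F_one : (1%g : G) \in F 0%N)
    (F_incr : forall n : nat, (F n `<=` F n.+1)%fset)
    (entropy_fin : top_entropy R act F < +oo)
    (K_neq0 : K !=set0) (K_souslin : souslin K)
    (tail_lt : tail_entropy R act F < bowen_entropy R act F K)
    (h : R) (h_ge0 : (0 <= h)%R)
    (h_le : h%:E <= bowen_entropy R act F K - tail_entropy R act F) :
  exists Kh : set X,
    [/\ Kh `<=` K,
        h%:E <= bowen_entropy R act F Kh
      & bowen_entropy R act F Kh <= h%:E + tail_entropy R act F].
Proof.
have [x0 Kx0] := K_neq0.
have F_unbounded := card_folner_unbounded G_infinite F_folner F_incr.
have a_ge0 := tail_entropy_ge0 act_cont F_folner x0.
have [a aE] : exists a : R, tail_entropy R act F = a%:E.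
  exists (fine (tail_entropy R act F)); rewrite fineK // ge0_fin_numE //.
  by apply: lt_le_trans tail_lt _; exact: leey.
rewrite aE in a_ge0 tail_lt h_le *; rewrite lee_fin in a_ge0.
have ha_le : (h + a)%:E <= bowen_entropy R act F K.
  by rewrite EFinD -leeBrDr.
(* A point serves for [h = 0], since the lowering works at a positive exponent below [h]. *)
move: h_ge0; rewrite le_eqVlt => /orP[/eqP h0|h_gt0].
  exists [set x0]; split; first by move=> _ ->.
    by rewrite -h0; exact: bowen_entropy_ge0.
  rewrite -h0 add0e; apply: (@le_trans _ _ 0); last by rewrite lee_fin.
  exact: (@bowen_entropy_set1 R G X act F F_unbounded x0).
have lowered j : exists L : set X, [/\ L `<=` K,
    (h - h / 2 ^+ j.+1)%:E <= bowen_entropy R act F L &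
    bowen_entropy R act F L <= (h + a)%:E].
  pose d : R := (h / 2 ^+ j.+1)%R.
  have d0 : (0 < d)%R by rewrite divr_gt0 // exprn_gt0.
  have dh : (d < h)%R.
    by rewrite ltr_pdivrMr ?exprn_gt0 // ltr_pMr // exprn_egt1 // ltr1n.
  have : tail_entropy R act F < (a + d / 3)%:E by rewrite aE lte_fin; lra.
  move=> /tail_entropy_lt [U covU Ub].
  (* Otherwise the entropy of [K] would be at most [(h - d + d / 6) + (a + d / 3) = h + a - d /
     2]. *)
  have nK : ~ null act F K U (h - d + d / 6)%R.
    move=> /(null_bowen_entropy_le act_cont F_folner x0 covU Ub).
    have h1 : (0 <= h - d + d / 6)%R by lra.
    move=> /(_ h1) /(le_trans ha_le); rewrite lee_fin; lra.
  have s0 : (0 < h - d)%R by lra.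
  have ss' : (h - d < h - d + d / 6)%R by lra.
  have st : (h - d < h - d + d / 3)%R by lra.
  have [L [LK LU sL]] := exists_lowered X_compact act_cont F_incr F_unbounded
    K_souslin covU s0 ss' st nK.
  exists L; split=> //.
  have t0 : (0 <= h - d + d / 3)%R by lra.
  apply: le_trans (null_bowen_entropy_le act_cont F_folner x0 covU Ub t0 LU) _.
  by rewrite lee_fin; lra.
(* No single [L j] need reach [h]. Their union does, by monotonicity, and countable stability keeps
   it below [h + a]. *)
pose L j := sval (cid (lowered j)); have LP j := svalP (cid (lowered j)).
exists (\bigcup_j L j); split.
- by move=> x [j _ Ljx]; have [LK _ _] := LP j; exact: LK.
- apply/lee_addgt0Pr => e e0; have [j je] : exists j, (h / 2 ^+ j.+1 <= e)%R.
    have eh : (0 < e / h)%R by exact: divr_gt0.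
    have [j _ /(_ j.+1 (leqnSn j)) /= jlt] := near_infty_natSinv_expn_lt (PosNum eh).
    by exists j; move: jlt; rewrite ltr_pdivlMr // => /ltW; rewrite mulrAC mul1r.
  have [_ sL _] := LP j.
  apply: (@le_trans _ _ ((h - h / 2 ^+ j.+1)%:E + e%:E)).
    by rewrite -EFinD lee_fin; lra.
  apply: leeD; last exact: lexx.
  apply: (le_trans sL); apply: bowen_entropyS => x Lx.
  by exists j.
rewrite -EFinD; apply: bowen_entropy_bigcup; first by rewrite addr_ge0 // ltW.
by move=> j; have [_ _ ?] := LP j.
Qed.
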